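(* For every $k\in\mathbb C$, $k\neq0$, the vertex algebra $N^k(\mathfrak{sl}_2)$ is strongly generated as follows. (i) If $k\neq0,-2,-17/16,-107/64$, then $N^k(\mathfrak{sl}_2)$ is strongly generated by $L,W,W^4,W^5$. (ii) If $k=-17/16$ or $k=-107/64$, then $N^k(\mathfrak{sl}_2)$ is strongly generated by $L,W,Z^4,Z^5$. (iii) If $k=-2$, then $N^{-2}(\mathfrak{sl}_2)$ is strongly generated by $S,W^3,W^4,W^5$; these generators have degrees $2,3,4,5$ in the standard grading.
   Context: $V^k(\mathfrak{sl}_2)$ ($k\in\mathbb C$) is the universal affine vertex algebra of level $k$, generated by $e(z),h(z),f(z)$ with $h(z)h(w)\sim\frac{2k}{(z-w)^2}$, $h(z)e(w)\sim\frac{2e(w)}{z-w}$, $h(z)f(w)\sim-\frac{2f(w)}{z-w}$, $e(z)f(w)\sim\frac{k}{(z-w)^2}+\frac{h(w)}{z-w}$; $a(z)=\sum_n a(n)z^{-n-1}$ for $a\in\mathfrak{sl}_2$. For $k\neq0$, $N^k(\mathfrak{sl}_2)=\{a\in V^k(\mathfrak{sl}_2)\mid h(n)a=0\text{ for all }n\ge0\}$ is the universal parafermion vertex algebra. The standard grading of $V^k(\mathfrak{sl}_2)$, inherited by $N^k(\mathfrak{sl}_2)$, is given by $\deg\mathbf 1=0$, $\deg(a(-n)v)=n+\deg v$ ($a\in\mathfrak{sl}_2$, $n\geq 1$). Vectors of $N^k(\mathfrak{sl}_2)$ (the final vacuum $\mathbf 1$ is omitted in mode formulas; $a_{(n)}b$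 denotes the $n$-th product). For $k\neq0,-2$: $$L=\tfrac1{2k(k+2)}(-kh(-2)-h(-1)^2+2ke(-1)f(-1)).$$ For all $k\ne0$ (including $k=-2$), $W=W^3$ and $$\begin{aligned}W^3={}&k^2h(-3)+3kh(-2)h(-1)+2h(-1)^3-6kh(-1)e(-1)f(-1)\\&+3k^2e(-2)f(-1)-3k^2e(-1)f(-2),\end{aligned}$$ $$\begin{aligned}W^4={}&-2k^2(k^2+k+1)h(-4)-8k(k^2+k+1)h(-3)h(-1)-k(5k^2-6)h(-2)^2\\&-2k(11k+6)h(-2)h(-1)^2-(11k+6)h(-1)^4+4k^2(6k-5)h(-2)e(-1)f(-1)\\&+4k(11k+6)h(-1)^2e(-1)f(-1)-4k^2(5k+11)h(-1)e(-2)f(-1)\\&+4k^2(5k+11)h(-1)e(-1)f(-2)+8k^2(k-3)(k-2)e(-3)f(-1)\\&-4k^2(3k^2-3k+8)e(-2)f(-2)-2k^2(6k-5)e(-1)^2f(-1)^2\\&+8k^2(k^2+k+1)e(-1)f(-3),\end{aligned}$$ $$\begin{aligned}W^5={}&-2k^3(k^2+3k+5)h(-5)-10k^2(k^2+3k+5)h(-4)h(-1)-5k^2(3k^2-4)h(-3)h(-2)\\&-5k(7k^2+12k+16)h(-3)h(-1)^2-15k(3k^2-4)h(-2)^2h(-1)\\&-5k(19k+12)h(-2)h(-1)^3-2(19k+12)h(-1)^5\\&+10k^2(4k^2-7k+8)h(-3)e(-1)f(-1)+20k^2(10k-7)h(-2)h(-1)e(-1)f(-1)\\&+10k(19k+1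2)h(-1)^3e(-1)f(-1)-5k^2(11k^2-14k+12)h(-2)e(-2)f(-1)\\&-5k^2(17k+64)h(-1)^2e(-2)f(-1)+15k^2(3k^2-4)h(-2)e(-1)f(-2)\\&+5k^2(17k+64)h(-1)^2e(-1)f(-2)+30k^2(k-4)(k-3)h(-1)e(-3)f(-1)\\&-40k^2(k^2+3k+5)h(-1)e(-2)f(-2)-10k^2(10k-7)h(-1)e(-1)^2f(-1)^2\\&+10k^2(3k^2+19k+8)h(-1)e(-1)f(-3)-10k^3(k-4)(k-3)e(-4)f(-1)\\&+20k^3(k-4)(k-3)e(-3)f(-2)+5k^3(10k-7)e(-2)e(-1)f(-1)^2\\&-10k^3(2k^2-4k+17)e(-2)f(-3)-5k^3(10k-7)e(-1)^2f(-2)f(-1)\\&+10k^3(k^2+3k+5)e(-1)f(-4).\end{aligned}$$ Further $Z^4=W_{(1)}W$, $Z^5=W_{(1)}Z^4$. At $k=-2$, $S=:ef:+:fe:+\frac12:hh:$ is the Segal–Sugawara field. *)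

(* Defs.v *)
From mathcomp Require Import all_boot all_order all_algebra.
From mathcomp Require Import classical_sets reals.
From mathcomp Require Import complex.

Set Implicit Arguments.
Unset Strict Implicit.
Unset Printing Implicit Defensive.

Import Order.TTheory GRing.Theory Num.Theory.
Local Open Scope ring_scope.
Local Open Scope classical_set_scope.

Definition binz (F : numFieldType) (m : int) (j : nat) : F :=
  (\prod_(i < j) (m - i%:Z)%:~R) / j`!%:R.

(* The two sides of the Borcherds identity are sums over all j >= 0 that have
   finite support by nprod_field; they are compared through their partial sums,
   which are eventually constant. *)
Record vertexAlgebra (F : numFieldType) := VertexAlgebra {
  va_sort :> lmodType F;
  vac : va_sort;
  nprod : va_sort -> int -> va_sort -> va_sort;
  nprod_linear_l : forall n b, linear (fun a => nprod a n b);
  nprod_linear_r : forall a n, linear (nprod a n);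
  nprod_field : forall a b, exists N : nat,
    forall n : int, N%:Z <= n -> nprod a n b = 0;
  nprod_vacl : forall n a, nprod vac n a = if n == -1 then a else 0;
  nprod_vacr : forall a, nprod a (-1) vac = a;
  nprod_vacr0 : forall a (n : int), 0 <= n -> nprod a n vac = 0;
  nprod_borcherds : forall a b c (l m n : int), exists N : nat,
    forall M : nat, (N <= M)%N ->
    \sum_(j < M) binz F m j *:
        nprod (nprod a (l + j%:Z) b) (m + n - j%:Z) c =
    \sum_(j < M) ((-1) ^+ j * binz F l j) *:
       (nprod a (m + l - j%:Z) (nprod b (n + j%:Z) c)
        - (-1) ^ l *: nprod b (n + l - j%:Z) (nprod a (m + j%:Z) c))
}.
Arguments vac {F v}.
Arguments nprod {F v} a n%_Z b.

(* a⟦n⟧ b is the n-th product of a and b; equivalently it is the mode a(n),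
   the coefficient of z^(-n-1) in a(z), applied to b. *)
Notation "a ⟦ n ⟧ b" := (nprod a n b)
  (at level 37, n at level 200, right associativity,
   format "a ⟦ n ⟧  b") : ring_scope.

Definition va_hom (F : numFieldType) (V U : vertexAlgebra F)
    (phi : {linear V -> U}) : Prop :=
  phi vac = vac /\ forall a (n : int) b, phi (a⟦n⟧ b) = (phi a)⟦n⟧ (phi b).

Record vertexSubalgebra (F : numFieldType) (V : vertexAlgebra F) :=
  VertexSubalgebra {
  vsub_set :> set V;
  vsub_submod : submod_closed (mem vsub_set);
  vsub_vac : vsub_set vac;
  vsub_nprod : forall a (n : int) b,
    vsub_set a -> vsub_set b -> vsub_set (a⟦n⟧ b)
}.

Definition generates (F : numFieldType) (V : vertexAlgebra F) (X : set V) :=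
  forall A : vertexSubalgebra V, X `<=` A -> A = setT :> set V.

Definition lspan (F : numFieldType) (V : lmodType F) (X : set V) : set V :=
  smallest (fun A : set V => submod_closed (mem A)) X.

(* A pair (a, n) stands for the operator a(-n). *)
Definition monomial (F : numFieldType) (V : vertexAlgebra F)
    (w : seq (V * nat)) : V :=
  foldr (fun p v => p.1⟦- p.2%:Z⟧ v) vac w.

Definition strongly_generated (F : numFieldType) (V : vertexAlgebra F)
    (A : vertexSubalgebra V) (gens : seq V) : Prop :=
  [set g | g \in gens] `<=` A /\
  A `<=` lspan [set monomial w | w in
    [set w : seq (V * nat) | all (fun p => (p.1 \in gens) && (0 < p.2)%N) w]].

(* a(z) b(w) ~ \sum_j c_j / (z - w)^(j+1) for c = [:: c_0; c_1; ..] *)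
Definition ope (F : numFieldType) (V : vertexAlgebra F) (a b : V)
    (c : seq V) : Prop :=
  forall n : nat, a⟦n%:Z⟧ b = c`_n.

(* The pairs not listed follow by skew-symmetry. *)
Definition affine_sl2 (F : numFieldType) (k : F) (V : vertexAlgebra F)
    (e h f : V) : Prop :=
  [/\ ope h h [:: 0; (2 * k) *: vac],
      ope h e [:: 2 *: e],
      ope h f [:: - 2 *: f],
      ope e f [:: h; k *: vac]
    & ope e e [::] /\ ope f f [::]].

(* (V, e, h, f) is the universal affine vertex algebra V^k(sl_2): it is initial
   among the vertex algebras with fields satisfying the level k relations. *)
Definition universal_affine_sl2 (F : numFieldType) (k : F)
    (V : vertexAlgebra F) (e h f : V) : Prop :=
  [/\ affine_sl2 k e h f,
      generates [set x | x \in [:: e; h; f]]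
    & forall (U : vertexAlgebra F) (e' h' f' : U), affine_sl2 k e' h' f' ->
      exists phi : {linear V -> U},
        [/\ va_hom phi, phi e = e', phi h = h' & phi f = f']].

Section ParafermionSubalgebra.
Context (F : numFieldType) (V : vertexAlgebra F) (h : V).

Fact nprod0 (a : V) n : a⟦n⟧ 0 = 0.
Proof.
by have := nprod_linear_r a n (-1) 0 0; rewrite scaler0 add0r scaleN1r addNr.
Qed.

Fact nprod0l (b : V) n : (0 : V)⟦n⟧ b = 0.
Proof.
have := nprod_linear_l n b (-1) (0 : V) 0.
by rewrite scaler0 add0r scaleN1r addNr.
Qed.

Let N : set V := [set a : V | forall n : int, 0 <= n -> h⟦n⟧ a = 0].

Fact parafermion_submod : submod_closed (mem N).
Proof.
split=> [|c u v]; rewrite !inE.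
- by move=> n _; rewrite nprod0.
- by move=> Nu Nv n n0; rewrite nprod_linear_r Nu // Nv // scaler0 addr0.
Qed.

Fact parafermion_vac : N vac.
Proof. by move=> n n0; rewrite nprod_vacr0. Qed.

Fact parafermion_nprod a (n : int) b : N a -> N b -> N (a⟦n⟧ b).
Proof.
move=> Na Nb m m0.
have [M HM] := nprod_borcherds h a b 0 m n.
have := HM M.+1 (leqnSn _).
rewrite big1 => [|j _]; last by rewrite add0r Na // nprod0l scaler0.
rewrite big_ord_recl big1 => [|j _]; last first.
  rewrite /binz big_ord_recl /= subrr mulr0z !mul0r mulr0 scale0r //.
rewrite /binz big_ord0 /= fact0 divr1 expr0 mulr1 expr0z !scale1r !addr0.
by rewrite Nb // nprod0 subr0 => <-.
Qed.

Definition parafermion : vertexSubalgebra V :=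
  VertexSubalgebra parafermion_submod parafermion_vac parafermion_nprod.

End ParafermionSubalgebra.

Definition standard_degree (F : numFieldType) (V : vertexAlgebra F)
    (e h f : V) (d : nat) : set V :=
  lspan [set monomial w | w in
    [set w : seq (V * nat) |
      all (fun p => (p.1 \in [:: e; h; f]) && (0 < p.2)%N) w
      /\ \sum_(p <- w) p.2 = d]].

Section Generators.
Context (F : numFieldType) (V : vertexAlgebra F) (k : F) (e h f : V).

Definition parafermion_L : V :=
  (2 * k * (k + 2))^-1 *:
    (- k *: h⟦-2⟧ vac - h⟦-1⟧ h⟦-1⟧ vac + (2 * k) *: e⟦-1⟧ f⟦-1⟧ vac).

Definition segal_sugawara : V :=
  e⟦-1⟧ f + f⟦-1⟧ e + 2^-1 *: h⟦-1⟧ h.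

Definition parafermion_W3 : V :=
  k ^+ 2 *: h⟦-3⟧ vac
  + (3 * k) *: h⟦-2⟧ h⟦-1⟧ vac
  + 2 *: h⟦-1⟧ h⟦-1⟧ h⟦-1⟧ vac
  - (6 * k) *: h⟦-1⟧ e⟦-1⟧ f⟦-1⟧ vac
  + (3 * k ^+ 2) *: e⟦-2⟧ f⟦-1⟧ vac
  - (3 * k ^+ 2) *: e⟦-1⟧ f⟦-2⟧ vac.

Definition parafermion_W4 : V :=
  - (2 * k ^+ 2 * (k ^+ 2 + k + 1)) *: h⟦-4⟧ vac
  - (8 * k * (k ^+ 2 + k + 1)) *: h⟦-3⟧ h⟦-1⟧ vac
  - (k * (5 * k ^+ 2 - 6)) *: h⟦-2⟧ h⟦-2⟧ vac
  - (2 * k * (11 * k + 6)) *: h⟦-2⟧ h⟦-1⟧ h⟦-1⟧ vac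
  - (11 * k + 6) *: h⟦-1⟧ h⟦-1⟧ h⟦-1⟧ h⟦-1⟧ vac
  + (4 * k ^+ 2 * (6 * k - 5)) *: h⟦-2⟧ e⟦-1⟧ f⟦-1⟧ vac
  + (4 * k * (11 * k + 6)) *: h⟦-1⟧ h⟦-1⟧ e⟦-1⟧ f⟦-1⟧ vac
  - (4 * k ^+ 2 * (5 * k + 11)) *: h⟦-1⟧ e⟦-2⟧ f⟦-1⟧ vac
  + (4 * k ^+ 2 * (5 * k + 11)) *: h⟦-1⟧ e⟦-1⟧ f⟦-2⟧ vac
  + (8 * k ^+ 2 * (k - 3) * (k - 2)) *: e⟦-3⟧ f⟦-1⟧ vac
  - (4 * k ^+ 2 * (3 * k ^+ 2 - 3 * k + 8)) *: e⟦-2⟧ f⟦-2⟧ vac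
  - (2 * k ^+ 2 * (6 * k - 5)) *: e⟦-1⟧ e⟦-1⟧ f⟦-1⟧ f⟦-1⟧ vac
  + (8 * k ^+ 2 * (k ^+ 2 + k + 1)) *: e⟦-1⟧ f⟦-3⟧ vac.

Definition parafermion_W5 : V :=
  - (2 * k ^+ 3 * (k ^+ 2 + 3 * k + 5)) *: h⟦-5⟧ vac
  - (10 * k ^+ 2 * (k ^+ 2 + 3 * k + 5)) *: h⟦-4⟧ h⟦-1⟧ vac
  - (5 * k ^+ 2 * (3 * k ^+ 2 - 4)) *: h⟦-3⟧ h⟦-2⟧ vac
  - (5 * k * (7 * k ^+ 2 + 12 * k + 16)) *: h⟦-3⟧ h⟦-1⟧ h⟦-1⟧ vac
  - (15 * k * (3 * k ^+ 2 - 4)) *: h⟦-2⟧ h⟦-2⟧ h⟦-1⟧ vac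
  - (5 * k * (19 * k + 12)) *: h⟦-2⟧ h⟦-1⟧ h⟦-1⟧ h⟦-1⟧ vac
  - (2 * (19 * k + 12)) *: h⟦-1⟧ h⟦-1⟧ h⟦-1⟧ h⟦-1⟧ h⟦-1⟧ vac
  + (10 * k ^+ 2 * (4 * k ^+ 2 - 7 * k + 8)) *: h⟦-3⟧ e⟦-1⟧ f⟦-1⟧ vac
  + (20 * k ^+ 2 * (10 * k - 7)) *: h⟦-2⟧ h⟦-1⟧ e⟦-1⟧ f⟦-1⟧ vac
  + (10 * k * (19 * k + 12)) *: h⟦-1⟧ h⟦-1⟧ h⟦-1⟧ e⟦-1⟧ f⟦-1⟧ vac
  - (5 * k ^+ 2 * (11 * k ^+ 2 - 14 * k + 12)) *: h⟦-2⟧ e⟦-2⟧ f⟦-1⟧ vac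
  - (5 * k ^+ 2 * (17 * k + 64)) *: h⟦-1⟧ h⟦-1⟧ e⟦-2⟧ f⟦-1⟧ vac
  + (15 * k ^+ 2 * (3 * k ^+ 2 - 4)) *: h⟦-2⟧ e⟦-1⟧ f⟦-2⟧ vac
  + (5 * k ^+ 2 * (17 * k + 64)) *: h⟦-1⟧ h⟦-1⟧ e⟦-1⟧ f⟦-2⟧ vac
  + (30 * k ^+ 2 * (k - 4) * (k - 3)) *: h⟦-1⟧ e⟦-3⟧ f⟦-1⟧ vac
  - (40 * k ^+ 2 * (k ^+ 2 + 3 * k + 5)) *: h⟦-1⟧ e⟦-2⟧ f⟦-2⟧ vac
  - (10 * k ^+ 2 * (10 * k - 7)) *: h⟦-1⟧ e⟦-1⟧ e⟦-1⟧ f⟦-1⟧ f⟦-1⟧ vac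
  + (10 * k ^+ 2 * (3 * k ^+ 2 + 19 * k + 8)) *: h⟦-1⟧ e⟦-1⟧ f⟦-3⟧ vac
  - (10 * k ^+ 3 * (k - 4) * (k - 3)) *: e⟦-4⟧ f⟦-1⟧ vac
  + (20 * k ^+ 3 * (k - 4) * (k - 3)) *: e⟦-3⟧ f⟦-2⟧ vac
  + (5 * k ^+ 3 * (10 * k - 7)) *: e⟦-2⟧ e⟦-1⟧ f⟦-1⟧ f⟦-1⟧ vac
  - (10 * k ^+ 3 * (2 * k ^+ 2 - 4 * k + 17)) *: e⟦-2⟧ f⟦-3⟧ vac
  - (5 * k ^+ 3 * (10 * k - 7)) *: e⟦-1⟧ e⟦-1⟧ f⟦-2⟧ f⟦-1⟧ vac
  + (10 * k ^+ 3 * (k ^+ 2 + 3 * k + 5)) *: e⟦-1⟧ f⟦-4⟧ vac.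

Definition parafermion_Z4 : V := parafermion_W3⟦1⟧ parafermion_W3.
Definition parafermion_Z5 : V := parafermion_W3⟦1⟧ parafermion_Z4.

End Generators.

(* Main.v *)
From HB Require Import structures.
From Stdlib Require Import BinInt.
Require Import Defs.
From mathcomp Require Import all_boot all_order all_algebra.
From mathcomp Require Import classical_sets reals.
From mathcomp Require Import complex.
From mathcomp Require Import ring zify ssrZ.

Set Implicit Arguments.
Unset Strict Implicit.
Unset Printing Implicit Defensive.

Import Order.TTheory GRing.Theory Num.Theory.
Local Open Scope ring_scope.

(** Why the theorem is true.

    Let [V0] be the charge zero subalgebra of [V], the kernel of [h(0)]; it
    contains the commutant [N] of the Heisenberg field [h]. Call a vector of
    positive degree of [V0] decomposable when it is a sum of products [u(-n)v]
    of charge zero vectors of smaller degree. By induction on the degree, any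
    homogeneous vectors that span [V0] modulo decomposables generate it strongly
    ([strong_generation]).

    Modulo decomposables one computes as follows. The algebra [V] is spanned by
    words in the creation operators of [e], [h] and [f]. Reordering a word, or
    splitting a charge zero subword off it as a factor, only costs shorter words.
    Hence a word that contains [h], or more than one pair [e], [f], is
    equivalent to a combination of the [e(-a)f(-b)vac], and integration by parts
    leaves in each degree [d] a single class, that of [e(-d+1)f(-1)vac]
    ([neutral_class]).

    In degree 6 and higher that class vanishes ([decoupling]). The word
    [e(-a)e(-1)f(-1)f(-2)vac] splits in several ways, because classically
    [(e(-a)f(-1))(e(-1)f(-2)) = (e(-a)f(-2))(e(-1)f(-1))]; comparing the quantum
    corrections gives, up to sign, [(a-1)a(a+4)k/6] times the class of [e(-a-3)f(-1)vac],
    and [k] is not zero. So [V0] is strongly generated by [h] and any four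
    vectors of degrees 2, 3, 4, 5 whose classes do not vanish.

    If these four vectors lie in [N], their modes commute with those of [h], so
    [V0] is spanned by products [h(-n1)...h(-nr)s] with [s] a monomial in the
    four vectors. Since [k] is not zero, the number operator
    [sum_n h(-n)h(n)/(2kn)] multiplies such a product by [r]; it kills [N], and
    therefore [N] is spanned by the monomials [s] ([parafermion_projection]).

    It remains to see that the vectors at hand lie in [N] and to compute their
    classes, which are, up to nonzero constants and powers of [k], 1 for [L], [S]
    and [W3], [16k+17] for [W4], [64k+107] for [W5], [2k+3] for [Z4] and
    [(2k+3)(3k+4)] for [Z5]. This explains the two exceptional levels. These
    finite computations are carried out by evaluation of a normalization
    procedure on words whose coefficients are integer polynomials in [k]. *)

(** * Spans and diagonalizable operators *)

Section Spans.
Context (F : numFieldType) (V : lmodType F).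
Implicit Types (A X Y : set V).

Definition is_submodule A :=
  A 0 /\ forall c u v, A u -> A v -> A (c *: u + v).

Lemma is_submoduleP A : is_submodule A <-> submod_closed (mem A).
Proof.
split=> [[A0 AD]|[A0 AD]]; split.
- by rewrite inE.
- by move=> c u v; rewrite !inE; apply: AD.
- by move: A0; rewrite inE.
- by move=> c u v Au Av; have := AD c u v; rewrite !inE; apply.
Qed.

(** Elements of [lspan X] as explicit linear combinations, to reason about them
    by induction. *)
Inductive spanned X : V -> Prop :=
| spanned0 : spanned X 0
| spanned_cons c u v : X u -> spanned X v -> spanned X (c *: u + v).

Lemma spanned_submodule X : is_submodule (spanned X).
Proof.
split=> [|c u v Xu Xv]; first exact: spanned0.
elim: Xu => [|d x y Xx _ IH]; first by rewrite scaler0 add0r.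
by rewrite scalerDr scalerA -addrA; apply: spanned_cons.
Qed.

Lemma subset_spanned X x : X x -> spanned X x.
Proof.
by move=> Xx; rewrite -[x]scale1r -[_ *: x]addr0; apply: spanned_cons => //; exact: spanned0.
Qed.

Lemma spanned_min X A : is_submodule A -> (forall x, X x -> A x) ->
  forall x, spanned X x -> A x.
Proof. by move=> [A0 AD] XA x; elim=> // c u v /XA Au _; apply: AD. Qed.

Lemma spanned_lspan X x : spanned X x -> lspan X x.
Proof.
move=> Xx B [BS XB]; have /(is_submoduleP B) BS' := BS.
exact: (spanned_min BS' XB).
Qed.

Section Closure.
Context (A : set V) (AS : is_submodule A).

Lemma submod0 : A 0. Proof. by case: AS. Qed.

Lemma submodZ c x : A x -> A (c *: x).
Proof. by move=> Ax; rewrite -[_ *: _]addr0; case: AS => A0; apply. Qed.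

Lemma submodD x y : A x -> A y -> A (x + y).
Proof. by move=> Ax Ay; rewrite -[x]scale1r; case: AS => _; apply. Qed.

Lemma submodN x : A x -> A (- x).
Proof. by rewrite -scaleN1r; apply: submodZ. Qed.

Lemma submodB x y : A x -> A y -> A (x - y).
Proof. by move=> Ax Ay; apply: submodD => //; apply: submodN. Qed.

Lemma submod_sum I (r : seq I) (P : pred I) (G : I -> V) :
  (forall i, P i -> A (G i)) -> A (\sum_(i <- r | P i) G i).
Proof. by move=> AG; elim/big_ind: _; [exact: submod0|exact: submodD|]. Qed.

End Closure.

Lemma spannedS X Y : (forall x, X x -> Y x) ->
  forall x, spanned X x -> spanned Y x.
Proof.
move=> XY; apply: spanned_min; first exact: spanned_submodule.
by move=> x /XY; apply: subset_spanned.
Qed.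

Lemma spanned_linear (L : V -> V) X A : linear L -> is_submodule A ->
  (forall v, X v -> A (L v)) -> forall v, spanned X v -> A (L v).
Proof.
move=> Llin AS XA; apply: spanned_min => //; split.
  by have := Llin (-1) 0 0; rewrite scaler0 addr0 scaleN1r addNr => ->; case: AS.
by move=> a u v Au Av; rewrite Llin; case: AS => _; apply.
Qed.

End Spans.

Section DiagonalOperators.
Context (F : numFieldType) (V : lmodType F) (D : V -> V) (D_lin : linear D).

Let D0 : D 0 = 0.
Proof. by have := D_lin (-1) 0 0; rewrite scaler0 addr0 scaleN1r addNr. Qed.

Let DZ a x : D (a *: x) = a *: D x.
Proof. by rewrite -[a *: x]addr0 D_lin D0 addr0. Qed.

Let DB x y : D (x - y) = D x - D y.
Proof. by rewrite addrC -scaleN1r D_lin scaleN1r addrC. Qed.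

(** [spectral_cut cs] multiplies a vector of [D]-eigenvalue [a] by the product
    of the [1 - a / c]: it is the identity on the kernel and annihilates the
    eigenvectors whose eigenvalue is listed in [cs]. *)
Definition spectral_cut (cs : seq F) (x : V) : V :=
  foldr (fun c y => y - c^-1 *: D y) x cs.

Let spectral_cut_lin cs c u v : spectral_cut cs (c *: u + v) =
                c *: spectral_cut cs u + spectral_cut cs v.
Proof.
elim: cs => //= b cs ->.
by rewrite D_lin scalerDr scalerBr !scalerA [b^-1 * c]mulrC opprD addrACA.
Qed.

Let spectral_cut_eigen cs a x : D x = a *: x ->
  spectral_cut cs x = (\prod_(c <- cs) (1 - c^-1 * a)) *: x.
Proof.
move=> Dx; elim: cs => [|c cs /= ->]; first by rewrite big_nil scale1r.
rewrite big_cons DZ Dx !scalerA -scalerBl; congr (_ *: _); ring.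
Qed.

Let spectral_cut_cat cs ds x :
  spectral_cut (cs ++ ds) x = spectral_cut cs (spectral_cut ds x).
Proof. by rewrite /spectral_cut foldr_cat. Qed.

Let spectral_cut_comm cs ds x :
  spectral_cut cs (spectral_cut ds x) = spectral_cut ds (spectral_cut cs x).
Proof.
elim: cs => //= c cs ->.
set y := spectral_cut cs x.
elim: ds => //= b ds <-.
rewrite !DB !DZ !scalerBr !scalerA.
by rewrite [b^-1 * c^-1]mulrC -!addrA; congr (_ + _); rewrite !opprD !opprK addrCA.
Qed.

(** A suitable [spectral_cut] maps the span of [X] to the span of the elements
    of [X] in the kernel, and it fixes the kernel pointwise. *)
Lemma kernel_of_diagonal (X : set V) :
  (forall x, X x -> exists a, D x = a *: x) ->
  forall x, spanned X x -> D x = 0 -> spanned [set y | X y /\ D y = 0]%classic x.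
Proof.
move=> DX.
have kerK cs y : D y = 0 -> spectral_cut cs y = y.
  move=> Dy; rewrite (@spectral_cut_eigen _ 0) ?Dy ?scale0r //.
  by rewrite big1 ?scale1r // => c _; rewrite mulr0 subr0.
pose K := spanned [set y | X y /\ D y = 0]%classic.
have KS : is_submodule K := spanned_submodule _.
have KD y : K y -> D y = 0.
  move: y; apply: spanned_min => [|y []//]; split; first exact: D0.
  by move=> c u v; rewrite D_lin => -> ->; rewrite scaler0 addr0.
suff cutK x : spanned X x -> exists2 cs, (0 : F) \notin cs & K (spectral_cut cs x).
  by move=> x /cutK[cs _]+ Dx0; rewrite kerK.
move: x; apply: spanned_min => [|x Xx].
  split; first by exists [::] => //=; exact: (submod0 KS).
  move=> c u v [cs cs0 Ku] [ds ds0 Kv]; exists (cs ++ ds).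
    by rewrite mem_cat negb_or cs0.
  rewrite spectral_cut_lin !spectral_cut_cat [spectral_cut cs (_ _ u)]spectral_cut_comm.
  rewrite [spectral_cut ds _]kerK ?[spectral_cut cs (_ _ v)]kerK; try exact: KD.
  by case: KS => _; apply.
have [a Dx] := DX x Xx; have [a0|a0] := eqVneq a 0.
  by exists [::] => //=; apply: subset_spanned; split=> //; rewrite Dx a0 scale0r.
exists [:: a]; first by rewrite inE eq_sym.
rewrite (spectral_cut_eigen _ Dx) big_seq1 mulVf // subrr scale0r.
exact: submod0 KS.
Qed.

End DiagonalOperators.

(** * Modes in a vertex algebra *)

Section Modes.
Context (F : numFieldType) (V : vertexAlgebra F).
Implicit Types (a b c u v x y : V) (m n : int) (i j p q : nat).

HB.instance Definition _ a n :=
  GRing.isLinear.Build F V V *:%R (nprod a n) (nprod_linear_r a n).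

Lemma nprodZl n k a c : (k *: a)⟦n⟧ c = k *: a⟦n⟧ c.
Proof. by have := nprod_linear_l n c k a 0; rewrite addr0 nprod0l addr0. Qed.

Lemma nprodDr n a b c : a⟦n⟧ (b + c) = a⟦n⟧ b + a⟦n⟧ c.
Proof. exact: linearD. Qed.

Lemma nprodZr n k a c : a⟦n⟧ (k *: c) = k *: a⟦n⟧ c.
Proof. exact: linearZ_LR. Qed.

Lemma nprodNr n a c : a⟦n⟧ (- c) = - (a⟦n⟧ c).
Proof. exact: linearN. Qed.

Lemma nprodBr n a b c : a⟦n⟧ (b - c) = a⟦n⟧ b - a⟦n⟧ c.
Proof. exact: linearB. Qed.

Lemma binz0 j : binz F 0 j = (j == 0)%:R.
Proof.
case: j => [|j]; first by rewrite /binz big_ord0 fact0 divr1.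
by rewrite /binz big_ord_recl subrr mulr0z !mul0r.
Qed.

Lemma binzn m : binz F m 0 = 1.
Proof. by rewrite /binz big_ord0 fact0 divr1. Qed.

Lemma binz1 m : binz F m 1 = m%:~R.
Proof. by rewrite /binz big_ord1 subr0 divr1. Qed.

Lemma binzN p j : (-1) ^+ j * binz F (Negz p) j = 'C(p + j, j)%:R.
Proof.
rewrite /binz mulrA.
have -> : (-1) ^+ j * \prod_(i < j) (Negz p - i%:Z)%:~R =
          \prod_(i < j) ((p + i).+1)%:R :> F.
  rewrite -[j in _ ^+ j]card_ord -prodr_const -big_split /=.
  apply: eq_bigr => i _; rewrite NegzE mulN1r -mulrNz.
  by rewrite [RHS]pmulrn; congr (_%:~R); lia.
apply: (mulIf (x := j`!%:R)); first by rewrite pnatr_eq0 -lt0n fact_gt0.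
rewrite mulfVK ?pnatr_eq0 -?lt0n ?fact_gt0 // -natrM bin_ffact.
rewrite -natr_prod; congr (_%:R).
elim: j => [|j IH]; first by rewrite big_ord0.
by rewrite big_ord_recr /= IH addnS ffactSS mulnC.
Qed.

(** The Borcherds identity with [l = 0], where only the term [j = 0] survives on
    the right; the double pole leaves two terms on the left. *)
Lemma commutator a b : (forall n, 2%:Z <= n -> a⟦n⟧ b = 0) ->
  forall m n c, a⟦m⟧ b⟦n⟧ c =
    b⟦n⟧ a⟦m⟧ c + (a⟦0⟧ b)⟦m + n⟧ c + m%:~R *: (a⟦1⟧ b)⟦m + n - 1⟧ c.
Proof.
move=> ab m n c; have [N /(_ N.+2 (leqW (leqnSn _))) abE] :=
  nprod_borcherds a b c 0 m n.
have {abE}: \sum_(j < N.+2) binz F m j *: (a⟦0 + j%:Z⟧ b)⟦m + n - j%:Z⟧ c =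
    a⟦m⟧ b⟦n⟧ c - b⟦n⟧ a⟦m⟧ c.
  rewrite abE big_ord_recl big1 => [|i _]; last first.
    by rewrite binz0 mulr0 scale0r.
  by rewrite binz0 expr0 mulr1 scale1r expr0z scale1r ?addr0.
rewrite 2!big_ord_recl big1 => [|i _]; last first.
  by rewrite ab ?nprod0l ?scaler0 //= add0r /bump /=; lia.
rewrite binzn binz1 subr0 addr0 scale1r !add0r => /eqP.
by rewrite addr0 eq_sym subr_eq addrC addrA => /eqP.
Qed.

Lemma commute_modes a b : (forall n, 0 <= n -> a⟦n⟧ b = 0) ->
  forall m n c, a⟦m⟧ b⟦n⟧ c = b⟦n⟧ a⟦m⟧ c.
Proof.
move=> ab m n c; rewrite commutator => [|i i2]; last by rewrite ab //; lia.
by rewrite !ab // !nprod0l scaler0 !addr0.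
Qed.

(** Associativity: the Borcherds identity with [m = 0], where only the term
    [j = 0] survives on the left. *)
Lemma iterate a b c p n : exists N, forall M, (N <= M)%N ->
  (a⟦Negz p⟧ b)⟦n⟧ c = \sum_(0 <= j < M) 'C(p + j, j)%:R *:
    (a⟦Negz (p + j)⟧ b⟦n + j%:Z⟧ c
     + (-1) ^+ p *: b⟦n - (p.+1 + j)%N%:Z⟧ a⟦j%:Z⟧ c).
Proof.
have [N NP] := nprod_borcherds a b c (Negz p) 0 n; exists N.+1 => M NM.
have := NP M (ltnW NM).
case: M NM => // M NM; rewrite [in LHS]big_ord_recl big1 => [|i _]; last first.
  by rewrite binz0 scale0r.
rewrite binz0 scale1r addr0 /= add0r subr0 addr0 => ->.
rewrite big_mkord; apply: eq_bigr => j _; rewrite binzN; congr (_ *: (_ + _)).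
  by congr (_⟦_⟧ _); rewrite !NegzE; lia.
rewrite -scaleNr add0r; congr (_ *: _⟦_⟧ _).
  rewrite -[(-1) ^ _]/(((-1) ^+ p.+1)^-1) -exprVn invrN1 exprS mulN1r.
  by rewrite opprK.
by rewrite NegzE; lia.
Qed.

Lemma vac_mode n c : (vac : V)⟦n⟧ c = if n == -1 then c else 0.
Proof. exact: nprod_vacl. Qed.

Lemma iterate_finite a b c p n B1 B2 :
  (forall j, (B1 <= j)%N -> b⟦n + j%:Z⟧ c = 0) ->
  (forall j, (B2 <= j)%N -> a⟦j%:Z⟧ c = 0) ->
  (a⟦Negz p⟧ b)⟦n⟧ c =
    \sum_(0 <= j < B1) 'C(p + j, j)%:R *: a⟦Negz (p + j)⟧ b⟦n + j%:Z⟧ c +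
    \sum_(0 <= j < B2) ((-1) ^+ p * 'C(p + j, j)%:R) *:
      b⟦n - (p.+1 + j)%N%:Z⟧ a⟦j%:Z⟧ c.
Proof.
have cut B M (G : nat -> V) : (B <= M)%N -> (forall j, (B <= j)%N -> G j = 0) ->
    \sum_(0 <= j < M) G j = \sum_(0 <= j < B) G j.
  move=> BM G0; rewrite (big_cat_nat (n := B)) //= [X in _ + X]big1_seq ?addr0 //.
  by move=> j; rewrite mem_index_iota => /andP[_ /andP[/G0]].
move=> bc ac; have [N /(_ (N + (B1 + B2))%N (leq_addr _ _)) ->] := iterate a b c p n.
under eq_bigr do rewrite scalerDr scalerA [_ * (-1) ^+ p]mulrC.
rewrite big_split /=; congr (_ + _); apply: cut; try lia.
  by move=> j /bc ->; rewrite nprod0 scaler0.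
by move=> j /ac ->; rewrite nprod0 scaler0.
Qed.

(** [g(-p-1)vac] is the divided power derivative of [g]. *)
Lemma derivative_mode (g v : V) p n : (g⟦Negz p⟧ vac)⟦n⟧ v =
  match n with
  | Negz q => 'C(p + q, q)%:R *: g⟦Negz (p + q)⟧ v
  | Posz m => if (p <= m)%N then ((-1) ^+ p * 'C(m, p)%:R) *: g⟦(m - p)%N%:Z⟧ v
              else 0
  end.
Proof.
have single q (G : nat -> V) M : (q < M)%N -> (forall j, j != q -> G j = 0) ->
    \sum_(0 <= j < M) G j = G q.
  move=> qM G0; rewrite (bigD1_seq q) ?iota_uniq ?mem_index_iota //= big1 ?addr0 //.
have [N NP] := iterate g vac v p n.
case: n NP => [m|q] NP; last first.
  rewrite (NP (N + q.+1)%N) ?leq_addr // (single q) ?leq_addl //.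
    by rewrite !vac_mode !ifT ?ifF ?nprod0 ?scaler0 ?addr0 // NegzE; lia.
  move=> j jq; rewrite !vac_mode !ifF ?nprod0 ?scaler0 ?addr0 ?scaler0 // NegzE; lia.
case: leqP => pm.
  rewrite (NP (N + (m - p).+1)%N) ?leq_addr // (single (m - p)%N) ?leq_addl //.
    have e1 : (m%:Z + (m - p)%N%:Z == -1) = false by lia.
    have e2 : (m%:Z - (p.+1 + (m - p))%N%:Z == -1) by lia.
    by rewrite !vac_mode e1 e2 nprod0 add0r scalerA mulrC subnKC // bin_sub.
  move=> j jq; rewrite !vac_mode !ifF ?nprod0 ?scaler0 ?addr0 ?scaler0 //; lia.
rewrite (NP N) // big1 // => j _; rewrite !vac_mode !ifF ?nprod0 ?scaler0 ?addr0 ?scaler0 //; lia.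
Qed.

End Modes.

(** * Words in the affine generators *)

Variant letter := E | H | F.

Definition letter_code x := match x with E => 0%N | H => 1%N | F => 2 end.

Lemma letter_code_inj : injective letter_code.
Proof. by do 2!case. Qed.

HB.instance Definition _ := Equality.copy letter (inj_type letter_code_inj).

Definition charge (x : letter) : int :=
  match x with E => 1 | H => 0 | F => -1 end.

(** The bracket of [x] and [y] is [bracket_coef x y] times
    [bracket_letter x y], and the central term is [pairing x y] times the level. *)
Definition bracket_letter x y :=
  match x, y with
  | H, E | E, H => E
  | H, F | F, H => F
  | _, _ => H
  end.

Definition bracket_coef x y : int :=
  match x, y with
  | H, E | F, H => 2
  | H, F | E, H => - 2
  | E, F => 1
  | F, E => -1
  | _, _ => 0
  end.

Definition pairing x y : int :=
  match x, y with
  | H, H => 2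
  | E, F | F, E => 1
  | _, _ => 0
  end.

(** The pair [(x, n)] is the creation operator [x(-n-1)], so that every word is
    a product of creation operators. *)
Definition word := seq (letter * nat).

Definition degree (w : word) : nat := foldr (fun p d => p.2.+1 + d)%N 0%N w.
Definition wcharge (w : word) : int := foldr (fun p c => charge p.1 + c) 0 w.

Lemma degree_cat w1 w2 : degree (w1 ++ w2) = (degree w1 + degree w2)%N.
Proof. by elim: w1 => //= p w1 ->; rewrite addnA. Qed.

Lemma wcharge_cat w1 w2 : wcharge (w1 ++ w2) = wcharge w1 + wcharge w2.
Proof. by elim: w1 => [|p w1 /= ->]; rewrite ?add0r ?addrA. Qed.

Section AffineWords.
Context (K : numFieldType) (k : K) (V : vertexAlgebra K) (e h f : V).
Context (aff : affine_sl2 k e h f).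
Implicit Types (x y z : letter) (w : word) (u v : V) (m n : int).

Definition gen x : V := match x with E => e | H => h | F => f end.

Definition state w : V := foldr (fun p v => gen p.1⟦Negz p.2⟧ v) vac w.

Lemma ope_commutator (a b : V) (c : seq V) : ope a b c -> (size c <= 2)%N ->
  forall m n v, a⟦m⟧ b⟦n⟧ v =
    b⟦n⟧ a⟦m⟧ v + (c`_0)⟦m + n⟧ v + m%:~R *: (c`_1)⟦m + n - 1⟧ v.
Proof.
move=> abc c2 m n v; rewrite -!abc; apply: commutator => -[] // i i2.
by rewrite abc nth_default // (leq_trans c2).
Qed.

Lemma gen_commutator x y m n v :
  gen x⟦m⟧ gen y⟦n⟧ v = gen y⟦n⟧ gen x⟦m⟧ v
    + (bracket_coef x y)%:~R *: gen (bracket_letter x y)⟦m + n⟧ v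
    + (if m + n == 0 then (m * pairing x y)%:~R * k else 0) *: v.
Proof.
have [hh he hf ef [ee ff]] := aff.
have eqN1 (i : int) : (i - 1 == -1) = (i == 0) by lia.
have HE i j u : h⟦i⟧ e⟦j⟧ u = e⟦j⟧ h⟦i⟧ u + 2%:~R *: e⟦i + j⟧ u.
  by rewrite (ope_commutator he) //= nprodZl nprod0l scaler0 addr0.
have HF i j u : h⟦i⟧ f⟦j⟧ u = f⟦j⟧ h⟦i⟧ u - 2%:~R *: f⟦i + j⟧ u.
  by rewrite (ope_commutator hf) //= nprodZl nprod0l scaler0 addr0 scaleNr.
have EF i j u : e⟦i⟧ f⟦j⟧ u = f⟦j⟧ e⟦i⟧ u + h⟦i + j⟧ u +
    (if i + j == 0 then i%:~R * k else 0) *: u.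
  rewrite (ope_commutator ef) //= nprodZl vac_mode eqN1.
  by case: eqP => _; rewrite ?scaler0 ?scale0r ?scalerA.
case: x; case: y; rewrite /= ?mulr0 ?mulr1 ?mulr0z ?mul0r ?if_same ?scale0r
  ?mulr1z ?scale1r ?addr0.
- by rewrite (ope_commutator ee) //= !nprod0l scaler0 !addr0.
- by rewrite HE [n + m]addrC mulrNz scaleNr addrK.
- exact: EF.
- exact: HE.
- rewrite (ope_commutator hh) //= nprod0l nprodZl vac_mode eqN1 addr0.
  case: eqP => _; rewrite ?scaler0 ?scale0r // scalerA intrM.
  by congr (_ + _ *: _); ring.
- by rewrite HF mulrNz scaleNr.
- rewrite EF [n + m]addrC mulrNz scaleNr scale1r.
  case: eqP => [/eqP|_]; last by rewrite !scale0r !addr0 addrK.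
  rewrite addr_eq0 => /eqP->; rewrite mulrNz mulNr scaleNr.
  by rewrite addrAC !addrK.
- by rewrite HF [n + m]addrC subrK.
- by rewrite (ope_commutator ff) //= !nprod0l scaler0 !addr0.
Qed.

(** The bound [s] on the number of letters is strict, so that
    [words 0] is the null space. It measures the errors: reordering letters, or replacing the
    [-1]-product of two words by their concatenation, only costs shorter words. *)
Definition words (s : nat) (c d : int) : set V :=
  spanned (fun v => exists w,
    [/\ (size w < s)%N, wcharge w = c, (degree w)%:Z = d & v = state w]).

Lemma words_submodule s c d : is_submodule (words s c d).
Proof. exact: spanned_submodule. Qed.
#[local] Hint Resolve words_submodule : core.

Let words0v s c d : words s c d 0 := submod0 (words_submodule s c d).
Let wordsD s c d := @submodD _ _ _ (words_submodule s c d).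
Let wordsZ s c d := @submodZ _ _ _ (words_submodule s c d).
Let words_sum s c d := @submod_sum _ _ _ (words_submodule s c d).

Lemma words_state w s : (size w < s)%N ->
  words s (wcharge w) (degree w) (state w).
Proof. by move=> ws; apply: subset_spanned; exists w. Qed.

Lemma words_le s t c d v : (s <= t)%N -> words s c d v -> words t c d v.
Proof.
move=> st; apply: spannedS => _ [w [ws wc wd ->]]; exists w; split=> //.
exact: leq_trans ws st.
Qed.

Lemma words_cast s t c c' d d' v : words s c d v ->
  (s <= t)%N -> c = c' -> d = d' -> words t c' d' v.
Proof. by move=> sv st <- <-; apply: words_le sv. Qed.

Lemma words_neg s c d v : words s c d v -> d < 0 -> v = 0.
Proof.
move=> sv d0; move: v sv; apply: spanned_min => [|v [w [_ _ wd _]]].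
  by split=> // a u v -> ->; rewrite scaler0 addr0.
by move: d0; rewrite -wd.
Qed.

Lemma words0 c d v : words 0 c d v -> v = 0.
Proof.
move: v; apply: spanned_min => [|v [w []//]].
by split=> // a u v -> ->; rewrite scaler0 addr0.
Qed.

Lemma bracket_charge x y : bracket_coef x y != 0 ->
  charge (bracket_letter x y) = charge x + charge y.
Proof. by case: x; case: y. Qed.

Lemma pairing_charge x y : pairing x y != 0 -> charge x + charge y = 0.
Proof. by case: x; case: y. Qed.

Lemma words_create x p s c d v : words s c d v ->
  words s.+1 (charge x + c) (p.+1%:Z + d) (gen x⟦Negz p⟧ v).
Proof.
move: v; apply: (spanned_linear (nprod_linear_r _ _)) => // _ [w [ws wc wd ->]].
have := @words_state ((x, p) :: w) s.+1 ws.
by rewrite /= wc PoszD wd.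
Qed.

Lemma words_annihilate x j s c d v : words s c d v ->
  words s (charge x + c) (d - j%:Z) (gen x⟦j%:Z⟧ v).
Proof.
move: v; apply: (spanned_linear (nprod_linear_r _ _)) => // _ [w [ws <- <- ->]] {c d}.
apply: (words_le ws).
elim: w x j {ws} => [|[y n] w IH] x j.
  by rewrite nprod_vacr0 //; exact: words0v.
rewrite [state _]/= gen_commutator.
apply: wordsD; first apply: wordsD.
- apply: (words_cast (words_create y n (IH x j))) => //=; first by rewrite addrCA.
  by rewrite PoszD addrA.
- have [->|/bracket_charge xy] := eqVneq (bracket_coef x y) 0.
    by rewrite scale0r; exact: words0v.
  apply: wordsZ; case jn: (j%:Z + Negz n) => [i|i].
    apply: (words_cast (IH (bracket_letter x y) i)) => //=.
      by rewrite xy addrA.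
    by rewrite -jn NegzE PoszD; lia.
  have := words_create (bracket_letter x y) i (words_state (ltnSn (size w))).
  move/words_cast; apply => //=; first by rewrite xy addrA.
  by move: jn; rewrite !NegzE => jn; lia.
- case: eqP => jn; last by rewrite scale0r; exact: words0v.
  have [->|/pairing_charge xy] := eqVneq (pairing x y) 0.
    by rewrite mulr0 mul0r scale0r; exact: words0v.
  apply: wordsZ.
  apply: (words_cast (words_state (ltnSn (size w)))) => //=.
    by rewrite addrA xy add0r.
  by move: jn; rewrite NegzE; lia.
Qed.

(** A mode [n >= 0] of a word costs a letter, because one of its letters has to
    be contracted with the vector acted upon. *)
Lemma words_nprod_state w n s c d v : words s.+1 c d v ->
  words (size w + s + (n < 0)%R) (wcharge w + c) ((degree w)%:Z + d - n - 1)
    (state w⟦n⟧ v).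
Proof.
elim: w n s c d v => [|[x p] w IH] n s c d v sv.
  rewrite /= vac_mode; case: eqP => [->|_]; last exact: words0v.
  by apply: (words_cast sv) => //=; [rewrite add0n addn1|lia|lia].
have [N /(_ N (leqnn N)) ->] := iterate (gen x) (state w) v p n.
apply: words_sum => j _; apply: wordsZ; apply: wordsD.
  have := words_create x (p + j) (IH (n + j%:Z) _ _ _ _ sv).
  move/words_cast; apply => /=; [|lia|lia].
  by case: ltP; case: ltP => //=; lia.
apply: wordsZ.
have := IH (n - (p.+1 + j)%N%:Z) s _ _ _ (words_annihilate x j sv).
move/words_cast; apply => /=; [|lia|lia].
by case: ltP; case: ltP => //=; lia.
Qed.

Lemma words_nprod s t c c' d d' u v n : words s c d u -> words t c' d' v ->
  words (s + t) (c + c') (d + d' - n - 1) (u⟦n⟧ v).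
Proof.
move=> su tv; move: u su; apply: (spanned_linear (nprod_linear_l _ _)) => // _ [w [ws <- <- ->]].
case: t tv => [/words0 ->|t tv].
  by rewrite nprod0; exact: words0v.
apply: (words_cast (words_nprod_state w n tv)) => //.
by case: (n < 0)%R => /=; lia.
Qed.

(** In the associativity formula for a first letter [x(-p-1)], the term [j = 0]
    is the concatenation; in all others some annihilation operator acts. *)
Lemma words_concat w1 w2 :
  words (size w1 + size w2) (wcharge w1 + wcharge w2)
    ((degree w1)%:Z + (degree w2)%:Z)
    (state w1⟦-1⟧ state w2 - state (w1 ++ w2)).
Proof.
elim: w1 => [|[x p] w1 IH].
  by rewrite /= vac_mode eqxx subrr; exact: words0v.
have [N /(_ N.+1 (leqnSn N)) ->] := iterate (gen x) (state w1) (state w2) p (-1).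
have w2s := words_state (ltnSn (size w2)).
have second j : words (size ((x, p) :: w1) + size w2)
    (wcharge ((x, p) :: w1) + wcharge w2)
    ((degree ((x, p) :: w1))%:Z + (degree w2)%:Z)
    ((-1) ^+ p *: state w1⟦-1 - (p.+1 + j)%N%:Z⟧ gen x⟦j%:Z⟧ state w2).
  apply: wordsZ.
  have := words_nprod_state w1 (-1 - (p.+1 + j)%N%:Z) (words_annihilate x j w2s).
  move/words_cast; apply => /=; [|lia|lia].
  by lia.
rewrite big_nat_recl // addn0 bin0 scale1r addr0.
rewrite -[X in X - _]addrA [_ - state _](addrAC (gen x⟦_⟧ _)); apply: wordsD.
  rewrite -[state (_ ++ _)]/(gen x⟦Negz p⟧ state (w1 ++ w2)) -nprodBr.
  by have := words_create x p IH; move/words_cast; apply => //=; lia.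
apply: wordsD; first exact: second.
apply: words_sum => j _; apply: wordsZ; apply: wordsD; last exact: second.
have := words_nprod_state w1 (-1 + j.+1%:Z) w2s.
move=> /(words_create x (p + j.+1)).
by move/words_cast; apply => /=; lia.
Qed.

Lemma words_to_front w1 p w2 :
  words (size (w1 ++ p :: w2)) (wcharge (w1 ++ p :: w2)) (degree (w1 ++ p :: w2))
    (state (w1 ++ p :: w2) - state (p :: w1 ++ w2)).
Proof.
elim: w1 => [|[y q] w1 IH] /=; first by rewrite subrr; exact: words0v.
case: p IH => x p IH.
have -> : state ((y, q) :: w1 ++ (x, p) :: w2) -
          state [:: (x, p), (y, q) & w1 ++ w2] =
    gen y⟦Negz q⟧ (state (w1 ++ (x, p) :: w2) - state ((x, p) :: w1 ++ w2)) +
    (gen y⟦Negz q⟧ gen x⟦Negz p⟧ state (w1 ++ w2) -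
     gen x⟦Negz p⟧ gen y⟦Negz q⟧ state (w1 ++ w2)).
  by rewrite nprodBr /= addrA subrK.
apply: wordsD.
  by have := words_create y q IH; move/words_cast; apply=> //; rewrite PoszD.
have qp0 : (Negz q + Negz p == 0) = false by rewrite !NegzE; lia.
rewrite (gen_commutator y x) qp0.
rewrite scale0r addr0 (addrAC (gen x⟦_⟧ _)) subrr add0r.
have [->|/bracket_charge xy] := eqVneq (bracket_coef y x) 0.
  by rewrite scale0r; exact: words0v.
apply: wordsZ.
have -> : Negz q + Negz p = Negz (q + p).+1 by rewrite !NegzE; lia.
have := words_create (bracket_letter y x) (q + p).+1
  (words_state (ltnSn (size (w1 ++ w2)))).
move/words_cast; apply => /=; first by rewrite !size_cat /=; lia.
  by rewrite xy !wcharge_cat /=; lia.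
by rewrite !degree_cat /=; lia.
Qed.

End AffineWords.

(** * Strong generation from indecomposables *)

Section Indecomposables.
Context (K : numFieldType) (k : K) (V : vertexAlgebra K) (e h f : V).
Context (aff : affine_sl2 k e h f).
Implicit Types (w : word) (u v : V) (a b d j m n p q : nat).

Local Notation state := (state e h f).
Local Notation words := (words e h f).

(** The charge zero vectors of degree [d]; the degree is an integer so that
    [neutral_nprod] needs no case distinction. *)
Definition neutral (d : int) v := exists s, words s 0 d v.

Lemma neutral_submodule (d : int) : is_submodule (neutral d).
Proof.
split=> [|c u v [s su] [t tv]]; first by exists 0%N; exact: spanned0.
exists (s + t)%N; have [_] := words_submodule e h f (s + t) 0 d; apply.
  by apply: words_le su; rewrite leq_addr.
by apply: words_le tv; rewrite leq_addl.
Qed.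

Lemma neutral_nprod (d d' : int) u v (n : int) : neutral d u -> neutral d' v ->
  neutral (d + d' - n - 1) (u⟦n⟧ v).
Proof.
by move=> [s su] [t tv]; exists (s + t)%N; have := words_nprod aff n su tv; rewrite addr0.
Qed.

Lemma neutral_neg (d : int) v : neutral d v -> d < 0 -> v = 0.
Proof. by case=> s; apply: words_neg. Qed.

Lemma neutral_state w : wcharge w = 0 -> neutral (degree w) (state w).
Proof. by move=> w0; exists (size w).+1; rewrite -w0; apply: words_state. Qed.

Lemma neutral_vac : neutral 0 vac.
Proof. exact: (@neutral_state [::]). Qed.

Lemma neutral_degree0 v : neutral 0 v -> exists c, v = c *: vac.
Proof.
case=> s; move: v; apply: spanned_min => [|_ [w [_ _ w0 ->]]].
  split=> [|c _ _ [x ->] [y ->]]; first by exists 0; rewrite scale0r.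
  by exists (c * x + y); rewrite scalerDl scalerA.
by case: w w0 => // _; exists 1; rewrite scale1r.
Qed.

(** The degree [d] part of the C_1-subspace of the charge zero subalgebra. The
    bound [q < d] only excludes the products [x(-1)y] with [x] in degree 0, and
    [y = vac], [m > 0] yields the derivatives of [x]. *)
Definition decomposable (d : nat) : V -> Prop :=
  spanned (fun v => exists p q m x y,
    [/\ (0 < p < d)%N, (q < d)%N & (p + q + m = d)%N] /\
    [/\ neutral p x, neutral q y & v = x⟦Negz m⟧ y]).

Lemma decomposable_submodule (d : nat) : is_submodule (decomposable d).
Proof. exact: spanned_submodule. Qed.

Lemma decomposable_nprod p q m (d : nat) x y : (0 < p < d)%N -> (q < d)%N ->
  (p + q + m = d)%N -> neutral p x -> neutral q y ->
  decomposable d (x⟦Negz m⟧ y).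
Proof.
by move=> pd qd pqm px qy; apply: subset_spanned; exists p, q, m, x, y.
Qed.

Section StrongGeneration.
Context (gens : seq (V * nat))
  (gens_neutral : forall g, g \in gens -> (0 < g.2)%N /\ neutral g.2 g.1)
  (gens_indecomposables : forall d v, (0 < d)%N -> neutral d v ->
    decomposable d v \/
    exists g c, (g, d) \in gens /\ decomposable d (v - c *: g)).

Definition gstate (l : seq (V * nat * nat)) : V :=
  foldr (fun g v => g.1.1⟦Negz g.2⟧ v) vac l.
Definition gdegree (l : seq (V * nat * nat)) : nat :=
  foldr (fun g d => g.1.2 + g.2 + d)%N 0%N l.

Let T (d : nat) := spanned (fun v => exists l,
  [/\ all (fun g => g.1 \in gens) l, gdegree l = d & v = gstate l]).

Let T_create g n (d : nat) v : g \in gens -> T d v -> T (g.2 + n + d) (g.1⟦Negz n⟧ v).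
Proof.
move=> gg; move: v; apply: (spanned_linear (nprod_linear_r _ _)) => [|_ [l [ww wd ->]]].
  exact: spanned_submodule.
by apply: subset_spanned; exists ((g, n) :: l); rewrite /= gg ww wd.
Qed.

Let gstate_neutral l : all (fun g => g.1 \in gens) l ->
  neutral (gdegree l) (gstate l).
Proof.
elim: l => [|[g n] l IH] /=; first by move=> _; exact: neutral_vac.
move=> /andP[/gens_neutral[_ gg] /IH wd].
have := neutral_nprod (Negz n) gg wd; congr neutral.
by rewrite NegzE /=; lia.
Qed.

Let nat_degree (d : int) v : neutral d v -> v = 0 \/ exists2 n : nat, d = n & neutral n v.
Proof.
case: d => [n|n] nv; first by right; exists n.
by left; apply: neutral_neg nv _.
Qed.

(** Degree induction. Expanding a mode of a product [g(-n-1)u] by associativity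
    leaves products whose factors have smaller degree, and generators applied to
    vectors of smaller degree. *)
Lemma strong_generation_graded (d : nat) v : neutral d v -> T d v.
Proof.
have TS d' := spanned_submodule (fun v => exists l,
  [/\ all (fun g => g.1 \in gens) l, gdegree l = d' & v = gstate l]).
elim/ltn_ind: d v => d IH v dv.
have [d0|d_gt0] := posnP d.
  have [c ->] : exists c, v = c *: vac by apply: neutral_degree0; move: dv; rewrite d0.
  apply: (submodZ (TS d)); apply: subset_spanned.
  by exists [::]; rewrite d0.
suff decT x : decomposable d x -> T d x.
  have [/decT//|[g [c [gg /decT xT]]]] := gens_indecomposables d_gt0 dv.
  rewrite -[v](subrK (c *: g)); apply: (submodD (TS d)) => //.
  apply: (submodZ (TS d)).
  apply: subset_spanned; exists [:: (g, d, 0%N)] => /=.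
  by rewrite gg !addn0 nprod_vacr.
suff wT l q m y : all (fun g => g.1 \in gens) l -> neutral q y -> (q < d)%N ->
    (gdegree l < d)%N -> (gdegree l + q + m = d)%N ->
    T d (gstate l⟦Negz m⟧ y).
  move: x; apply: (spanned_min (TS d)).
  move=> _ [p [q [m [x [y [[/andP[_ pd] qd pqm] [px qy ->]]]]]]].
  have := IH p pd x px; move: x {px}.
  apply: (spanned_linear (nprod_linear_l _ _) (TS d)) => _ [l [wg wp ->]].
  by apply: (wT l q); rewrite ?wp.
elim: l q m y => [|[[g r] n] l wIH] q m y /=.
  rewrite vac_mode; case: eqP => [/eqP|_ _ _ _ _ _]; last exact: submod0 (TS d).
  by rewrite NegzE eqr_opp; lia.
move=> /andP[gg wg] qy qd wd wqm.
have [/= r0 gr] := gens_neutral gg.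
have [N /(_ N (leqnn N)) ->] := iterate g (gstate l) y n (Negz m).
apply: (submod_sum (TS d)) => j _; apply: (submodZ (TS d)).
apply: (submodD (TS d)).
  have /nat_degree := neutral_nprod (Negz m + j%:Z) (gstate_neutral wg) qy.
  case=> [->|[D DE Dy]]; first by rewrite nprod0; exact: submod0 (TS d).
  move: DE; rewrite NegzE => DE.
  have -> : d = (r + (n + j) + D)%N by lia.
  by apply: (T_create _ gg); apply: IH => //; lia.
apply: (submodZ (TS d)).
have /nat_degree := neutral_nprod j%:Z gr qy.
case=> [->|[D DE Dy]]; first by rewrite nprod0; exact: submod0 (TS d).
have -> : Negz m - (n.+1 + j)%N%:Z = Negz (m + n.+1 + j) by rewrite !NegzE; lia.
by apply: (wIH D) => //; lia.
Qed.

Lemma strong_generation (d : nat) v : neutral d v ->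
  spanned (fun v => exists l : seq (V * nat),
    all (fun g => g.1 \in unzip1 gens) l /\
    v = foldr (fun g v => g.1⟦Negz g.2⟧ v) vac l) v.
Proof.
move/strong_generation_graded; apply: spannedS => _ [l [wg _ ->]].
exists [seq (g.1.1, g.2) | g <- l]; split; last by elim: l {wg} => //= g l ->.
rewrite all_map; apply: sub_all wg => g gg /=.
by apply/mapP; exists g.1.
Qed.
End StrongGeneration.
End Indecomposables.

(** * The class of a charge zero vector *)

Section Quadratics.
Context (K : numFieldType) (k : K) (V : vertexAlgebra K) (e h f : V).
Context (aff : affine_sl2 k e h f).
Implicit Types (w : word) (u v : V) (a b d j m n p q : nat).

Local Notation state := (state e h f).
Local Notation words := (words e h f).
Local Notation neutral := (neutral e h f).
Local Notation decomposable := (decomposable e h f).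

Let decD d := @submodD _ _ _ (decomposable_submodule e h f d).
Let decB d := @submodB _ _ _ (decomposable_submodule e h f d).
Let decZ d := @submodZ _ _ _ (decomposable_submodule e h f d).
Let dec0 d : decomposable d 0 := submod0 (decomposable_submodule e h f d).

Definition quadratic a b : V := state [:: (E, a); (F, b)].

Lemma quadratic_neutral a b : neutral (a + b).+2 (quadratic a b).
Proof.
by have := @neutral_state _ _ e h f [:: (E, a); (F, b)] erefl; congr neutral => /=; lia.
Qed.

(** The translation operator [v -> v(-2)vac] is a derivation. *)
Lemma translation_create (g v : V) p :
  (g⟦Negz p⟧ v)⟦Negz 1⟧ vac =
  g⟦Negz p⟧ v⟦Negz 1⟧ vac + p.+1%:R *: g⟦Negz p.+1⟧ v.
Proof.
have [N /(_ N.+2 (leqW (leqnSn _))) ->] := iterate g v vac p (Negz 1).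
rewrite 2?big_nat_recl // big1_seq => [|i _].
  rewrite !(nprod_vacr0 g) // !nprod0 !scaler0 !addr0 bin0 scale1r addn0.
  by rewrite bin1 addn1 (_ : Negz 1 + 1%:Z = -1) // nprod_vacr.
by rewrite (nprod_vacr0 g) // nprod_vacr0 ?nprod0 ?scaler0 ?addr0 ?scaler0 // NegzE; lia.
Qed.

Lemma quadratic_translation a b : decomposable (a + b + 3)
  (a.+1%:R *: quadratic a.+1 b + b.+1%:R *: quadratic a b.+1).
Proof.
have -> : a.+1%:R *: quadratic a.+1 b + b.+1%:R *: quadratic a b.+1 =
    quadratic a b⟦Negz 1⟧ vac.
  rewrite /quadratic /= !translation_create vac_mode /= nprodDr nprodZr !nprod0 add0r.
  by rewrite addrC.
apply: (decomposable_nprod (p := (a + b).+2) (q := 0)); try lia.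
  exact: quadratic_neutral.
exact: neutral_vac.
Qed.

(** Derivatives are decomposable, so integration by parts moves all derivatives
    to [e]. *)
Lemma quadratic_class a b : decomposable (a + b).+2
  (quadratic a b - ((-1) ^+ b * 'C(a + b, b)%:R) *: quadratic (a + b) 0).
Proof.
elim: b a => [|b IH] a.
  by rewrite addn0 bin0 mulr1 scale1r subrr; exact: dec0.
have b0 : b.+1%:R != 0 :> K by rewrite pnatr_eq0.
have -> : (a + b.+1).+2 = (a.+1 + b).+2 by lia.
have -> : (a + b.+1)%N = (a.+1 + b)%N by lia.
have := quadratic_translation a b.
have -> : (a + b + 3)%N = (a.+1 + b).+2 by lia.
move/(decZ (b.+1%:R^-1)).
move/decB => /(_ _ (decZ (b.+1%:R^-1 * a.+1%:R) (IH a.+1))).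
congr decomposable.
rewrite scalerDr !scalerA mulVf // scale1r scalerBr scalerA opprB.
rewrite addrC addrA subrK addrC; congr (_ + _); rewrite -scaleNr; congr (_ *: _).
rewrite exprS mulN1r mulNr opprK mulrCA; congr (_ * _).
apply: (mulfI b0); rewrite mulrA [X in X * _]mulrA mulfV // mul1r -!natrM.
by congr (_%:R); rewrite mul_bin_left addnK.
Qed.

(** [v] has class [c] when it is [c] times [e(-d+1)f(-1)vac] up to
    decomposables. *)
Definition has_class d v c := decomposable d (v - c *: quadratic d.-2 0).

Lemma has_classD d u v (a b : K) : has_class d u a -> has_class d v b ->
  has_class d (u + v) (a + b).
Proof. by rewrite /has_class scalerDl opprD addrACA; apply: decD. Qed.

Lemma has_classZ d v (a b : K) : has_class d v b -> has_class d (a *: v) (a * b).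
Proof. by rewrite /has_class -scalerA -scalerBr; apply: decZ. Qed.

Lemma has_classN d v (b : K) : has_class d v b -> has_class d (- v) (- b).
Proof. by move=> vb; rewrite -scaleN1r -(mulN1r b); apply: has_classZ. Qed.

Lemma has_classB d u v (a b : K) : has_class d u a -> has_class d v b ->
  has_class d (u - v) (a - b).
Proof. by move=> ua vb; apply: has_classD => //; apply: has_classN. Qed.

Lemma has_class0 d v : has_class d v 0 <-> decomposable d v.
Proof. by rewrite /has_class scale0r subr0. Qed.

Lemma has_class_zero d : has_class d 0 0.
Proof. by apply/has_class0; exact: dec0. Qed.

Lemma has_class_sub d u v c : decomposable d (u - v) -> has_class d v c ->
  has_class d u c.
Proof. by move=> uv /(decD uv); rewrite addrA subrK. Qed.

Lemma has_class_quadratic d a b : (a + b).+2 = d ->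
  has_class d (quadratic a b) ((-1) ^+ b * 'C(d.-2, b)%:R).
Proof. by move=> <-; exact: quadratic_class. Qed.

Lemma decomposable_create_h p w d : wcharge w = 0 -> (p.+1 + degree w = d)%N ->
  (1 < d)%N -> decomposable d (h⟦Negz p⟧ state w).
Proof.
move=> w0 wd d1; apply: (decomposable_nprod (p := 1) (q := degree w)); try lia.
  have := @neutral_state _ _ e h f [:: (H, 0%N)] erefl.
  by rewrite /= nprod_vacr.
exact: neutral_state.
Qed.

Lemma letters_neq_H w : all (fun l => l.1 != H) w ->
  wcharge w = (count (fun l => l.1 == E) w)%:Z - (count (fun l => l.1 == F) w)%:Z.
Proof. by elim: w => //= -[[] n] w IH //= /IH ->; lia. Qed.

(** Induction on the number of letters. A letter [h] moved to the front is a
    factor; otherwise a pair [e], [f] moved to the front is a factor, unless it is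
    the whole word. *)
Lemma words_class d s v : (1 < d)%N -> words s 0 d v ->
  exists c, has_class d v c.
Proof.
move=> d1; elim: s v => [|s IH] v.
  by move/words0 ->; exists 0; apply/has_class0.
have front w1 (l : letter * nat) w2 : (size (w1 ++ l :: w2) < s.+1)%N ->
    wcharge (w1 ++ l :: w2) = 0 -> degree (w1 ++ l :: w2) = d ->
    exists c, has_class d (state (w1 ++ l :: w2) - state (l :: w1 ++ w2)) c.
  move=> ws w0 wd; apply: IH; have := words_to_front aff w1 l w2.
  by move/words_cast; apply; rewrite ?wd.
move: v; apply: spanned_min => [|_ [w [ws w0 [wd] ->]]].
  split; first by exists 0; apply/has_class0; exact: dec0.
  move=> a u v [b ub] [c vc]; exists (a * b + c); apply: has_classD => //.
  exact: has_classZ.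
have [wH|wH] := boolP (has (fun l => l.1 == H) w).
  have /hasP[[y n] nw /eqP /= yH] := wH; rewrite {y}yH in nw.
  case/splitPr: nw ws w0 wd {wH} => w1 w2 ws w0 wd.
  have [c cP] := front _ _ _ ws w0 wd; exists (c + 0).
  rewrite -[state _](subrK (state ((H, n) :: w1 ++ w2))).
  apply: has_classD => //; apply/has_class0.
  apply: decomposable_create_h => //.
    by rewrite -w0 !wcharge_cat /= add0r.
  by rewrite -wd !degree_cat /=; lia.
rewrite -all_predC in wH.
have charge_count := letters_neq_H wH.
have size_count : size w = (count (fun l => l.1 == E) w + count (fun l => l.1 == F) w)%N.
  by elim: (w) wH => //= -[[] n] u IHu //= /IHu ->; lia.
have w_gt0 : (0 < size w)%N by case: (w) wd => //=; lia.
have /hasP[[y b] bw /eqP /= yF] : has (fun l => l.1 == F) w.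
  by rewrite has_count; lia.
rewrite {y}yF in bw.
have aw : has (fun l => l.1 == E) w by rewrite has_count; lia.
case/splitPr: bw ws w0 wd {wH charge_count size_count w_gt0} aw => w1 w2 ws w0 wd aw.
have [c1 c1P] := front _ _ _ ws w0 wd.
have /hasP[[y a] aw' /eqP /= yE] : has (fun l => l.1 == E) (w1 ++ w2).
  by move: aw; rewrite !has_cat /=.
rewrite {y}yE in aw'.
have ws' : (size ((F, b) :: w1 ++ w2) < s.+1)%N.
  by move: ws; rewrite /= !size_cat /=; lia.
have w0' : wcharge ((F, b) :: w1 ++ w2) = 0.
  by rewrite -w0 /= !wcharge_cat /=; lia.
have wd' : degree ((F, b) :: w1 ++ w2) = d.
  by rewrite -wd /= !degree_cat /=; lia.
case/splitPr: aw' c1P ws' w0' wd' => u1 u2 c1P ws' w0' wd'.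
have [c2 c2P] := front ((F, b) :: u1) _ _ ws' w0' wd'.
rewrite -[state _](subrK (state ((F, b) :: u1 ++ (E, a) :: u2))).
rewrite -[X in _ + X](subrK (state [:: (E, a), (F, b) & u1 ++ u2])) addrA.
suff [c cP] : exists c, has_class d (state [:: (E, a), (F, b) & u1 ++ u2]) c.
  by exists (c1 + c2 + c); apply: has_classD => //; apply: has_classD.
have u0 : wcharge (u1 ++ u2) = 0.
  by move: w0'; rewrite /= !wcharge_cat /=; lia.
have ud : ((a + b).+2 + degree (u1 ++ u2) = d)%N.
  by move: wd'; rewrite /= !degree_cat /=; lia.
case uE: (u1 ++ u2) => [|p u].
  by eexists; apply: has_class_quadratic; move: ud; rewrite uE /= addn0.
rewrite -uE; have u_gt0 : (0 < degree (u1 ++ u2))%N by rewrite uE; case: (p).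
have us : (size [:: (E, a); (F, b)] + size (u1 ++ u2) <= s)%N.
  by move: ws'; rewrite /= !size_cat /=; lia.
have dE : (degree [:: (E, a); (F, b)])%:Z + (degree (u1 ++ u2))%:Z = d.
  by rewrite -ud /=; lia.
have cE : wcharge [:: (E, a); (F, b)] + wcharge (u1 ++ u2) = 0 by rewrite u0.
have [c cP] := IH _ (words_cast (words_concat aff _ _) us cE dE).
exists (0 - c); rewrite -[state _](subKr (quadratic a b⟦-1⟧ state (u1 ++ u2))).
apply: has_classB cP; apply/has_class0.
apply: (decomposable_nprod (p := (a + b).+2) (q := degree (u1 ++ u2)) (m := 0)); try lia.
  exact: quadratic_neutral.
exact: neutral_state.
Qed.

Lemma neutral_class d v : (1 < d)%N -> neutral d v -> exists c, has_class d v c.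
Proof. by move=> d1 [s]; apply: words_class. Qed.

Lemma neutral_degree1 v : neutral 1 v -> exists c, v = c *: h.
Proof.
case=> s; move: v; apply: spanned_min => [|_ [w [_ w0 [wd] ->]]].
  split=> [|c _ _ [x ->] [y ->]]; first by exists 0; rewrite scale0r.
  by exists (c * x + y); rewrite scalerDl scalerA.
exists 1; rewrite scale1r.
by case: w w0 wd => [|[[] [|n]] [|[y m] w]] //= _ _; rewrite nprod_vacr.
Qed.

End Quadratics.

(** * Decoupling in degree at least 6 *)

Section Decoupling.
Context (K : numFieldType) (k : K) (V : vertexAlgebra K) (e h f : V).
Context (aff : affine_sl2 k e h f).
Implicit Types (v : V) (m n : int) (a b j p q x y z : nat).

Local Notation state := (state e h f).
Local Notation neutral := (neutral e h f).
Local Notation decomposable := (decomposable e h f).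
Local Notation quadratic := (quadratic e h f).
Local Notation has_class := (has_class e h f).

Let fe m n v : f⟦m⟧ e⟦n⟧ v = e⟦n⟧ f⟦m⟧ v - h⟦m + n⟧ v +
  (if m + n == 0 then m%:~R * k else 0) *: v.
Proof. by rewrite (gen_commutator aff F E) /= mulr1 scaleN1r. Qed.

Let hf m n v : h⟦m⟧ f⟦n⟧ v = f⟦n⟧ h⟦m⟧ v - 2 *: f⟦m + n⟧ v.
Proof.
by rewrite (gen_commutator aff H F) /= mulr0 mul0r if_same scale0r addr0 scaleNr.
Qed.

Let eh m n v : e⟦m⟧ h⟦n⟧ v = h⟦n⟧ e⟦m⟧ v - 2 *: e⟦m + n⟧ v.
Proof.
by rewrite (gen_commutator aff E H) /= mulr0 mul0r if_same scale0r addr0 scaleNr.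
Qed.

Let fh m n v : f⟦m⟧ h⟦n⟧ v = h⟦n⟧ f⟦m⟧ v + 2 *: f⟦m + n⟧ v.
Proof.
by rewrite (gen_commutator aff F H) /= mulr0 mul0r if_same scale0r addr0.
Qed.

Let ef m n v : e⟦m⟧ f⟦n⟧ v = f⟦n⟧ e⟦m⟧ v + h⟦m + n⟧ v +
  (if m + n == 0 then m%:~R * k else 0) *: v.
Proof. by rewrite (gen_commutator aff E F) /= mulr1 scale1r. Qed.

Let ff m n v : f⟦m⟧ f⟦n⟧ v = f⟦n⟧ f⟦m⟧ v.
Proof.
by rewrite (gen_commutator aff F F) /= !mulr0 mul0r if_same !scale0r !addr0.
Qed.

(** The class of [quadratic a b] in degree [d]. *)
Let s d b : K := (-1) ^+ b * 'C(d.-2, b)%:R.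

Let NegzD x y : Negz x + Negz y = Negz (x + y).+1.
Proof. by rewrite !NegzE; lia. Qed.

Lemma has_class_ehf d x y z : (x + y + z).+3 = d ->
  has_class d (e⟦Negz x⟧ h⟦Negz y⟧ f⟦Negz z⟧ vac) (- (2 * s d z)).
Proof.
move=> dE; rewrite eh -[- (2 * _)]add0r; apply: has_classB.
  apply/has_class0.
  by apply: (@decomposable_create_h _ _ e h f _ [:: (E, x); (F, z)]) => //=; lia.
apply: has_classZ; rewrite NegzD; apply: has_class_quadratic => //; lia.
Qed.

Lemma has_class_fe d x z : (x + z).+2 = d ->
  has_class d (f⟦Negz x⟧ e⟦Negz z⟧ vac) (s d x).
Proof.
move=> dE; rewrite fe NegzD /= scale0r addr0 -[s d x]subr0; apply: has_classB.
  by apply: has_class_quadratic => //; lia.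
by apply/has_class0; apply: (@decomposable_create_h _ _ e h f _ [::]) => //=; lia.
Qed.

Lemma has_class_feh d x y z : (x + y + z).+3 = d ->
  has_class d (f⟦Negz x⟧ e⟦Negz z⟧ h⟦Negz y⟧ vac)
    (2 * s d (x + y).+1 - 2 * s d x).
Proof.
move=> dE; rewrite eh nprodBr nprodZr fh !NegzD; apply: has_classB; last first.
  by apply: has_classZ; apply: has_class_fe; lia.
rewrite -[2 * _]add0r; apply: has_classD; last first.
  by apply: has_classZ; apply: has_class_fe; lia.
apply/has_class0; rewrite fe NegzD /= scale0r addr0 nprodBr.
apply: (submodB (decomposable_submodule e h f d)).
  by apply: (@decomposable_create_h _ _ e h f _ [:: (E, z); (F, x)]) => //=; lia.
by apply: (@decomposable_create_h _ _ e h f _ [:: (H, _)]) => //=; lia.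
Qed.

Let f_annihilates z j : f⟦j%:Z⟧ f⟦Negz z⟧ vac = 0.
Proof. by rewrite ff nprod_vacr0 // nprod0. Qed.

Let f_quadratic0 z : f⟦0⟧ quadratic 0%N z = - (h⟦-1⟧ f⟦Negz z⟧ vac).
Proof. by rewrite /quadratic /= fe f_annihilates nprod0 add0r scale0r addr0. Qed.

Let h_mode z j : h⟦j%:Z⟧ f⟦Negz z⟧ vac = - (2 *: f⟦j%:Z + Negz z⟧ vac).
Proof. by rewrite hf nprod_vacr0 // nprod0 add0r. Qed.

Let f_quadratic1 z : f⟦1⟧ quadratic 0%N z = (k + 2) *: f⟦Negz z⟧ vac.
Proof.
rewrite /quadratic /= fe f_annihilates nprod0 add0r mul1r.
have hz : h⟦0⟧ f⟦Negz z⟧ vac = - (2 *: f⟦Negz z⟧ vac).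
  by rewrite hf nprod_vacr0 // nprod0 !add0r.
by rewrite (_ : 1 + Negz 0 = 0) // eqxx hz opprK addrC -scalerDl.
Qed.

Let f_quadratic2 z j : f⟦j.+2%:Z⟧ quadratic 0%N z = 2 *: f⟦j.+1%:Z + Negz z⟧ vac.
Proof.
rewrite /quadratic /= fe f_annihilates nprod0 add0r.
rewrite (_ : j.+2%:Z + Negz 0 = j.+1%:Z); last by rewrite NegzE; lia.
by rewrite scale0r addr0 h_mode opprK.
Qed.

Let e_quadratic z j : e⟦j%:Z⟧ quadratic 0%N z = e⟦-1⟧ h⟦j%:Z + Negz z⟧ vac
   + (if j == z.+1 then j%:R * k else 0) *: e⟦-1⟧ vac.
Proof.
have ee m n v : e⟦m⟧ e⟦n⟧ v = e⟦n⟧ e⟦m⟧ v.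
  by rewrite (gen_commutator aff E E) /= !mulr0 mul0r if_same !scale0r !addr0.
rewrite /quadratic /= ee ef nprod_vacr0 // nprod0 add0r nprodDr nprodZr.
by rewrite -[j%:~R]/(j%:R) (_ : (j%:Z + Negz z == 0) = (j == z.+1)) // NegzE; lia.
Qed.

(** The modes of [e(-a-1)f(-1)vac] on a vector [v] of degree at most 3, where
    the annihilation operators that enter stop at [j = 3]. *)
Lemma has_class_nprod d a n v (ce cf : nat -> K) :
  (forall j, (4 <= j)%N -> f⟦n + j%:Z⟧ v = 0) ->
  (forall j, (4 <= j)%N -> e⟦j%:Z⟧ v = 0) ->
  (forall j, (j < 4)%N -> has_class d (e⟦Negz (a + j)⟧ f⟦n + j%:Z⟧ v) (ce j)) ->
  (forall j, (j < 4)%N ->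
     has_class d (f⟦n - (a.+1 + j)%N%:Z⟧ e⟦j%:Z⟧ v) (cf j)) ->
  has_class d (quadratic a 0⟦n⟧ v)
    (\sum_(0 <= j < 4) 'C(a + j, j)%:R * (ce j + (-1) ^+ a * cf j)).
Proof.
move=> fv ev ceP cfP; rewrite /quadratic /= nprod_vacr (iterate_finite a fv ev).
under [in X in _ + X]eq_bigr do rewrite mulrC -scalerA.
rewrite -big_split /=; under eq_bigr do rewrite -scalerDr.
rewrite unlock /=.
by do 4?[apply: has_classD; first by apply: has_classZ; apply: has_classD;
  [apply: ceP|apply: has_classZ; apply: cfP]]; apply/has_class0;
  exact: submod0 (decomposable_submodule e h f d).
Qed.

Lemma has_class_unique d v (a b : K) : has_class d v a -> has_class d v b ->
  decomposable d ((a - b) *: quadratic d.-2 0).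
Proof.
move=> va vb; have := submodB (decomposable_submodule e h f d) vb va.
by congr decomposable; rewrite opprB addrC subrKA scalerBl.
Qed.

Let e_quadratic_le z y j : (j + y = z)%N ->
  e⟦j%:Z⟧ quadratic 0%N z = e⟦Negz 0⟧ h⟦Negz y⟧ vac.
Proof.
move=> <-; rewrite e_quadratic ifF ?scale0r ?addr0; last by lia.
by congr (_⟦_⟧ _⟦_⟧ _); rewrite !NegzE; lia.
Qed.

Let e_quadratic_pole z : e⟦z.+1%:Z⟧ quadratic 0%N z =
  (z.+1%:R * k) *: e⟦Negz 0⟧ vac.
Proof. by rewrite e_quadratic eqxx nprod_vacr0 ?nprod0 ?add0r // NegzE; lia. Qed.

Let e_quadratic_gt z j : (z.+1 < j)%N -> e⟦j%:Z⟧ quadratic 0%N z = 0.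
Proof.
move=> zj; rewrite e_quadratic ifF ?scale0r ?addr0; last by lia.
by rewrite nprod_vacr0 ?nprod0 // NegzE; lia.
Qed.

Let f_quadratic_gt z j : (z.+1 < j)%N -> f⟦j%:Z⟧ quadratic 0%N z = 0.
Proof.
case: j => [|[|j]] // zj; rewrite f_quadratic2 nprod_vacr0 ?scaler0 // NegzE; lia.
Qed.

(** Three decomposable products of degree [a + 5]. Their leading words have the
    unknown classes [omega] and [zeta], which cancel in the combination used
    below. The lists give the terms [j = 0, ..., 3] of the associativity formula:
    first [e(-a-j-1)] applied to a mode of [f], then a mode of [f] applied to
    [e(j)]. *)
Section Relations.
Context (a : nat) (omega zeta : K).
Let d := a.+3.+2.
Context
  (omegaP : has_class d (state [:: (E, a); (E, 0%N); (F, 0%N); (F, 1%N)]) omega)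
  (zetaP : has_class d (e⟦Negz a.+1⟧ f⟦-1⟧ quadratic 0 0) zeta).

Lemma class_nprod_mixed : has_class d (quadratic a 0⟦-1⟧ quadratic 0 1)
  (\sum_(0 <= j < 4) 'C(a + j, j)%:R *
    ([:: omega + 2 * s d 1; 2 * s d 1; (k + 2) * s d 1; 2 * s d 0]`_j +
     (-1) ^+ a * [:: 2 * s d a.+3 - 2 * s d a.+1; 2 * s d a.+3 - 2 * s d a.+2;
                     2%:R * k * s d a.+3; 0]`_j)).
Proof.
apply: has_class_nprod => [j j4|j j4||].
- rewrite (_ : -1 + j%:Z = j.-1%:Z); last by lia.
  by rewrite f_quadratic_gt //; lia.
- by rewrite e_quadratic_gt //; lia.
- case=> [|[|[|[|//]]]] _ /=.
  + rewrite addn0 addr0 /quadratic /= fe /= scale0r addr0 nprodBr.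
    rewrite -[2 * _]opprK; apply: has_classB; first exact: omegaP.
    by apply: has_class_ehf; rewrite /d; lia.
  + rewrite f_quadratic0 nprodNr -[2 * _]opprK; apply: has_classN.
    by apply: has_class_ehf; rewrite /d; lia.
  + rewrite f_quadratic1 nprodZr; apply: has_classZ.
    by apply: has_class_quadratic; rewrite /d; lia.
  + rewrite (f_quadratic2 1 0) nprodZr; apply: has_classZ.
    by apply: has_class_quadratic; rewrite /d; lia.
- case=> [|[|[|[|//]]]] _ /=.
  + rewrite (@e_quadratic_le 1 1 0) // (_ : -1 - _ = Negz a.+1); last by rewrite NegzE; lia.
    by have := @has_class_feh d a.+1 1 0; rewrite addn1; apply; rewrite /d; lia.
  + rewrite (@e_quadratic_le 1 0 1) // (_ : -1 - _ = Negz a.+2); last by rewrite NegzE; lia.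
    by have := @has_class_feh d a.+2 0 0; rewrite !addn0; apply; rewrite /d; lia.
  + rewrite e_quadratic_pole nprodZr; apply: has_classZ.
    rewrite (_ : -1 - _ = Negz a.+3); last by rewrite NegzE; lia.
    by apply: has_class_fe; rewrite /d; lia.
  + by rewrite e_quadratic_gt // nprod0; exact: has_class_zero.
Qed.

Lemma class_nprod_shifted : has_class d (quadratic a 0⟦-2⟧ quadratic 0 0)
  (\sum_(0 <= j < 4) 'C(a + j, j)%:R *
    ([:: omega + 2 * s d 0; zeta; 2 * s d 0; (k + 2) * s d 0]`_j +
     (-1) ^+ a * [:: 2 * s d a.+3 - 2 * s d a.+2; 1 * k * s d a.+3; 0; 0]`_j)).
Proof.
apply: has_class_nprod => [j j4|j j4||].
- rewrite (_ : -2 + j%:Z = j.-2%:Z); last by lia.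
  by rewrite f_quadratic_gt //; lia.
- by rewrite e_quadratic_gt //; lia.
- case=> [|[|[|[|//]]]] _ /=.
  + rewrite addn0 addr0 /quadratic /= fe /= scale0r addr0 nprodBr.
    rewrite -[2 * _]opprK; apply: has_classB; first by rewrite ff; exact: omegaP.
    by apply: has_class_ehf; rewrite /d; lia.
  + by rewrite addn1 (_ : -2 + 1%:Z = -1) //; exact: zetaP.
  + rewrite f_quadratic0 nprodNr -[2 * _]opprK; apply: has_classN.
    by apply: has_class_ehf; rewrite /d; lia.
  + rewrite f_quadratic1 nprodZr; apply: has_classZ.
    by apply: has_class_quadratic; rewrite /d; lia.
- case=> [|[|[|[|//]]]] _ /=.
  + rewrite (@e_quadratic_le 0 0 0) // (_ : -2 - _ = Negz a.+2); last by rewrite NegzE; lia.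
    by have := @has_class_feh d a.+2 0 0; rewrite !addn0; apply; rewrite /d; lia.
  + rewrite e_quadratic_pole nprodZr; apply: has_classZ.
    rewrite (_ : -2 - _ = Negz a.+3); last by rewrite NegzE; lia.
    by apply: has_class_fe; rewrite /d; lia.
  + by rewrite e_quadratic_gt // nprod0; exact: has_class_zero.
  + by rewrite e_quadratic_gt // nprod0; exact: has_class_zero.
Qed.

Lemma class_nprod_square : has_class d (quadratic a.+1 0⟦-1⟧ quadratic 0 0)
  (\sum_(0 <= j < 4) 'C(a.+1 + j, j)%:R *
    ([:: zeta; 2 * s d 0; (k + 2) * s d 0; 0]`_j +
     (-1) ^+ a.+1 * [:: 2 * s d a.+3 - 2 * s d a.+2; 1 * k * s d a.+3; 0; 0]`_j)).
Proof.
apply: has_class_nprod => [j j4|j j4||].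
- rewrite (_ : -1 + j%:Z = j.-1%:Z); last by lia.
  by rewrite f_quadratic_gt //; lia.
- by rewrite e_quadratic_gt //; lia.
- case=> [|[|[|[|//]]]] _ /=.
  + by rewrite addn0 addr0; exact: zetaP.
  + rewrite f_quadratic0 nprodNr -[2 * _]opprK; apply: has_classN.
    by apply: has_class_ehf; rewrite /d; lia.
  + rewrite f_quadratic1 nprodZr addn2; apply: has_classZ.
    by apply: has_class_quadratic; rewrite /d; lia.
  + by rewrite (_ : -1 + 3%:Z = 2) // f_quadratic_gt // nprod0; exact: has_class_zero.
- case=> [|[|[|[|//]]]] _ /=.
  + rewrite (@e_quadratic_le 0 0 0) // (_ : -1 - _ = Negz a.+2); last by rewrite NegzE; lia.
    by have := @has_class_feh d a.+2 0 0; rewrite !addn0; apply; rewrite /d; lia.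
  + rewrite e_quadratic_pole nprodZr; apply: has_classZ.
    rewrite (_ : -1 - _ = Negz a.+3); last by rewrite NegzE; lia.
    by apply: has_class_fe; rewrite /d; lia.
  + by rewrite e_quadratic_gt // nprod0; exact: has_class_zero.
  + by rewrite e_quadratic_gt // nprod0; exact: has_class_zero.
Qed.

End Relations.

Let binR2 i : 'C(i.+2, 2)%:R = i.+2%:R * i.+1%:R / 2 :> K.
Proof.
apply: (canRL (mulfK _)); first by rewrite pnatr_eq0.
by rewrite -!natrM; congr (_%:R); have := bin_ffact i.+2 2; rewrite !ffactnS ffactn0 /= => ->; lia.
Qed.

Let binR3 i : 'C(i.+3, 3)%:R = i.+3%:R * i.+2%:R * i.+1%:R / 6 :> K.
Proof.
apply: (canRL (mulfK _)); first by rewrite pnatr_eq0.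
by rewrite -!natrM; congr (_%:R); have := bin_ffact i.+3 3; rewrite !ffactnS ffactn0 /= => ->; lia.
Qed.

(** The combination of the three products in which the leading words cancel has
    class [- k b (b + 1) (b + 5) / 6], and it is decomposable. *)
Let decoupling_shift b : k != 0 -> (0 < b)%N ->
  decomposable b.+2.+3 (quadratic b.+3 0).
Proof.
move=> k0 b_gt0; set d := b.+2.+3.
have [//|omega omegaP] := @neutral_class _ k _ e h f aff d
  (state [:: (E, b); (E, 0%N); (F, 0%N); (F, 1%N)]) erefl.
  have := @neutral_state _ _ e h f [:: (E, b); (E, 0%N); (F, 0%N); (F, 1%N)] erefl.
  by congr neutral; rewrite /= /d; lia.
have [//|zeta zetaP] := @neutral_class _ k _ e h f aff d
  (e⟦Negz b.+1⟧ f⟦-1⟧ quadratic 0 0) erefl.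
  have := @neutral_state _ _ e h f [:: (E, b.+1); (F, 0%N); (E, 0%N); (F, 0%N)] erefl.
  by congr neutral; rewrite /= /d; lia.
have product p (x : V) q (y : V) (i : nat) : (0 < p < d)%N -> (q < d)%N ->
    (p + q + i = d)%N -> neutral p x -> neutral q y -> has_class d (x⟦Negz i⟧ y) 0.
  by move=> *; apply/has_class0; apply: (decomposable_nprod (p := p) (q := q)).
have qn := quadratic_neutral e h f.
have A : has_class d (quadratic b 0⟦-1⟧ quadratic 0 1) 0.
  by apply: (product _ _ _ _ 0%N _ _ _ (qn _ _) (qn _ _)); rewrite /d; lia.
have B : has_class d (quadratic b 0⟦-2⟧ quadratic 0 0) 0.
  by apply: (product _ _ _ _ 1%N _ _ _ (qn _ _) (qn _ _)); rewrite /d; lia.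
have D : has_class d (quadratic b.+1 0⟦-1⟧ quadratic 0 0) 0.
  by apply: (product _ _ _ _ 0%N _ _ _ (qn _ _) (qn _ _)); rewrite /d; lia.
have := has_class_unique (has_classD
  (has_classB (class_nprod_mixed omegaP) (class_nprod_shifted omegaP zetaP))
  (has_classZ b.+1%:R (class_nprod_square zetaP)))
  (has_classD (has_classB A B) (has_classZ b.+1%:R D)).
set c := (X in X *: _).
have -> : c = - (k * b%:R * b.+1%:R * (b + 5)%:R / 6).
  have sM : s d b.+3 = - (-1) ^+ b.
    by rewrite /s binn mulr1 !exprS; ring.
  have sM1 : s d b.+2 = (-1) ^+ b * b.+3%:R.
    by rewrite /s binSn !exprS; ring.
  have sM2 : s d b.+1 = - (-1) ^+ b * (b.+3%:R * b.+2%:R / 2).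
    have -> : s d b.+1 = (-1) ^+ b.+1 * 'C(b.+3, 2)%:R.
      by rewrite -(bin_sub (n := b.+3)) // !subSS subn0.
    by rewrite binR2 exprS; ring.
  have s0 : s d 0 = 1 by rewrite /s bin0 expr0 mulr1.
  have s1 : s d 1 = - b.+3%:R by rewrite /s bin1 expr1 mulN1r.
  rewrite /c {c A B D} unlock /= {}sM {}sM1 {}sM2 {}s0 {}s1.
  rewrite !bin0 !bin1 !addn1 !addn2 !addn3 !binR2 !binR3 exprS.
  by rewrite -signr_odd; case: (odd b); rewrite ?expr0 ?expr1; field.
rewrite -[d.-2]/b.+3.
have c0 : - (k * b%:R * b.+1%:R * (b + 5)%:R / 6) != 0.
  by rewrite oppr_eq0 !mulf_neq0 ?invr_eq0 ?pnatr_eq0 //; lia.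
move/(submodZ (decomposable_submodule e h f d)
  (- (k * b%:R * b.+1%:R * (b + 5)%:R / 6))^-1).
by rewrite scalerA mulVf // scale1r.
Qed.

Lemma decoupling d : k != 0 -> (5 < d)%N -> decomposable d (quadratic d.-2 0).
Proof.
by case: d => [|[|[|[|[|[|a]]]]]] // k0 _; apply: (@decoupling_shift a.+1).
Qed.

End Decoupling.

(** * Evaluation of modes on formal combinations of words *)

(** A coefficient is the list of the coefficients of a polynomial in the level,
    starting with the constant term. *)
Definition coef := seq Z.

Fixpoint cadd (p q : coef) : coef :=
  match p, q with
  | [::], _ => q
  | _, [::] => p
  | a :: p', b :: q' => (a + b)%R :: cadd p' q'
  end.

Fixpoint cmul (p q : coef) : coef :=
  if p is a :: p' then cadd [seq (a * b)%R | b <- q] (0%R :: cmul p' q) else [::].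

Definition form := seq (coef * word).

Definition fscale (c : coef) (v : form) : form := [seq (cmul c t.1, t.2) | t <- v].

Definition fbind (g : word -> form) (v : form) : form :=
  flatten [seq fscale t.1 (g t.2) | t <- v].

Definition fword w : form := [:: ([:: 1%R : Z], w)].

Fixpoint annihilate (x : letter) (j : nat) (w : word) : form :=
  if w is (y, n) :: w' then
    [seq (t.1, (y, n) :: t.2) | t <- annihilate x j w'] ++
    fscale [:: Z_of_int (bracket_coef x y)]
      (if (j <= n)%N then fword ((bracket_letter x y, n - j)%N :: w')
       else annihilate (bracket_letter x y) (j - n.+1) w') ++
    (if j == n.+1 then [:: ([:: 0%R; Z_of_int (j%:Z * pairing x y)], w')]
     else [::])
  else [::].

(** The two sums of the associativity formula stop where degrees become
    negative; a single letter has the closed formula [derivative_mode], which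
    keeps the recursion short. *)
Fixpoint fmode (w : word) (n : int) (y : word) : form :=
  match w with
  | [::] => if n == -1 then fword y else [::]
  | [:: (x, p)] =>
    match n with
    | Negz q => [:: ([:: Z_of_int 'C(p + q, q)%:Z], (x, p + q)%N :: y)]
    | Posz m =>
      if (p <= m)%N then
        fscale [:: Z_of_int ((-1) ^+ p * 'C(m, p)%:Z)] (annihilate x (m - p) y)
      else [::]
    end
  | (x, p) :: u =>
    flatten [seq fscale [:: Z_of_int 'C(p + j, j)%:Z]
        (fbind (fun z => fword ((x, p + j)%N :: z)) (fmode u (n + j%:Z) y))
      | j <- iota 0 (if ((degree u + degree y)%N%:Z - n)%R is Posz b then b else 0%N)] ++
    flatten [seq fscale [:: Z_of_int ((-1) ^+ p * 'C(p + j, j)%:Z)]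
        (fbind (fmode u (n - (p.+1 + j)%N%:Z)) (annihilate x j y))
      | j <- iota 0 (degree y).+1]
  end.

Lemma fmode_cons x p q w n y :
  let u := q :: w in fmode ((x, p) :: u) n y =
    flatten [seq fscale [:: Z_of_int 'C(p + j, j)%:Z]
        (fbind (fun z => fword ((x, p + j)%N :: z)) (fmode u (n + j%:Z) y))
      | j <- iota 0 (if ((degree u + degree y)%N%:Z - n)%R is Posz b then b else 0%N)] ++
    flatten [seq fscale [:: Z_of_int ((-1) ^+ p * 'C(p + j, j)%:Z)]
        (fbind (fmode u (n - (p.+1 + j)%N%:Z)) (annihilate x j y))
      | j <- iota 0 (degree y).+1].
Proof. by []. Qed.

Definition precedes (p q : letter * nat) : bool :=
  match p.1, q.1 with
  | H, H | E, E | F, F => (q.2 <= p.2)%N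
  | H, _ | E, F => true
  | _, _ => false
  end.

(** The value is correct whatever the fuel; too little fuel only leaves the word
    unordered. *)
Fixpoint insert (fuel : nat) (p : letter * nat) (w : word) : form :=
  match fuel, w with
  | fuel'.+1, q :: w' =>
    if precedes p q then fword (p :: w) else
    fbind (insert fuel' q) (insert fuel' p w') ++
    fscale [:: Z_of_int (bracket_coef p.1 q.1)]
      (insert fuel' (bracket_letter p.1 q.1, (p.2 + q.2).+1) w')
  | _, _ => fword (p :: w)
  end.

Fixpoint add_term (t : coef * word) (v : form) : form :=
  if v is s :: v' then
    if s.2 == t.2 then (cadd s.1 t.1, s.2) :: v' else s :: add_term t v'
  else [:: t].

Definition collect (v : form) : form :=
  [seq t <- foldr add_term [::] v | has (fun a => a != 0%R) t.1].

Fixpoint order_word (fuel : nat) (w : word) : form :=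
  if w is p :: w' then fbind (insert fuel p) (order_word fuel w') else fword [::].

Definition normalize (v : form) : form := collect (fbind (order_word 10) v).

Definition fnprod (v : form) (n : int) (v' : form) : form :=
  normalize (fbind (fun y => fbind (fun w => fmode w n y) v) v').

Definition homogeneous (d : nat) (v : form) : bool :=
  all (fun t => (wcharge t.2 == 0) && (degree t.2 == d)) v.

(** The modes [h(n)] with [n > d] vanish on degree [d]. *)
Definition commutes_with_h (d : nat) (v : form) : bool :=
  homogeneous d v &&
  all (fun n => nilp (normalize (fbind (annihilate H n) v))) (iota 0 d.+1).

(** The word minus a decomposable vector: the whole word if it starts with [h],
    and otherwise the product of its first pair [e], [f] with the remaining
    letters, which cancels the terms of the same length. *)
Definition split_word (w : word) : form :=
  match w with
  | (H, _) :: _ => [::]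
  | [:: (E, _); (F, _)] => fword w
  | (E, a) :: u =>
    let i := find (fun p => p.1 == F) u in
    let b := (nth (F, 0%N) u i).2 in
    let y := take i u ++ drop i.+1 u in
    if (wcharge y == 0) && (0 < degree y)%N
       && ((a + b).+2 + degree y == degree w)%N then
      fword w ++ fscale [:: (-1)%R] (fmode [:: (E, a); (F, b)] (-1) y)
    else fword w
  | _ => fword w
  end.

Definition split_form (v : form) : form := normalize (fbind split_word v).

Definition quadratic_coef (t : coef * word) : coef :=
  if t.2 is [:: (E, a); (F, b)] then
    cmul t.1 [:: Z_of_int ((-1) ^+ b * 'C(a + b, b)%:Z)]
  else [::].

Definition is_quadratic (w : word) : bool :=
  if w is [:: (E, _); (F, _)] then true else false.

(** Splitting twice suffices for words with at most two letters [E] and two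
    letters [F]: the second round removes the letters [H] created by the first. *)
Definition class_of (d : nat) (v : form) : option coef :=
  let v1 := split_form v in let v2 := split_form v1 in
  if [&& homogeneous d v, homogeneous d v1, homogeneous d v2
       & all (fun t => is_quadratic t.2) v2]
  then Some (foldr (fun t => cadd (quadratic_coef t)) [::] v2) else None.

Section Evaluation.
Context (K : numFieldType) (k : K) (V : vertexAlgebra K) (e h f : V).
Context (aff : affine_sl2 k e h f).
Implicit Types (p q : coef) (w y : word) (v : form).

Local Notation state := (state e h f).
Local Notation gen := (gen e h f).
Local Notation neutral := (neutral e h f).
Local Notation decomposable := (decomposable e h f).
Local Notation has_class := (has_class e h f).

Definition ceval (p : coef) : K :=
  foldr (fun a x => (int_of_Z a)%:~R + k * x) 0 p.

Definition feval (v : form) : V := \sum_(t <- v) ceval t.1 *: state t.2.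

Lemma fevalE v : feval v = \sum_(t <- v) ceval t.1 *: state t.2.
Proof. by []. Qed.

Lemma ceval_add p q : ceval (cadd p q) = ceval p + ceval q.
Proof.
elim: p q => [|a p IH] [|b q] /=; rewrite ?add0r ?addr0 //.
by rewrite IH !rmorphD /=; ring.
Qed.

Lemma ceval_mul p q : ceval (cmul p q) = ceval p * ceval q.
Proof.
elim: p q => [|a p IH] q /=; first by rewrite mul0r.
rewrite ceval_add /= IH rmorph0 add0r mulrDl mulrA; congr (_ + _).
by elim: q => [|b q IHq] /=; rewrite ?mulr0 // IHq !rmorphM /=; ring.
Qed.

Lemma ceval_int (i : int) : ceval [:: Z_of_int i] = i%:~R.
Proof. by rewrite /= mulr0 addr0 Z_of_intK. Qed.

Lemma feval_nil : feval [::] = 0.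
Proof. by rewrite /feval big_nil. Qed.

Lemma feval_cons t v : feval (t :: v) = ceval t.1 *: state t.2 + feval v.
Proof. by rewrite /feval big_cons. Qed.

Lemma feval_cat v v' : feval (v ++ v') = feval v + feval v'.
Proof. by rewrite /feval big_cat. Qed.

Lemma feval_scale p v : feval (fscale p v) = ceval p *: feval v.
Proof.
rewrite /feval scaler_sumr big_map; apply: eq_bigr => t _ /=.
by rewrite ceval_mul scalerA.
Qed.

Lemma feval_word w : feval (fword w) = state w.
Proof.
by rewrite /feval big_seq1 -[ceval _]/(ceval [:: Z_of_int 1]) ceval_int scale1r.
Qed.

Lemma feval_flatten (I : Type) (r : seq I) (G : I -> form) :
  feval (flatten [seq G i | i <- r]) = \sum_(i <- r) feval (G i).
Proof.
elim: r => [|i r IH]; first by rewrite big_nil feval_nil.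
by rewrite big_cons /= feval_cat IH.
Qed.

Lemma feval_bind g v :
  feval (fbind g v) = \sum_(t <- v) ceval t.1 *: feval (g t.2).
Proof. by rewrite feval_flatten; apply: eq_bigr => t _; rewrite feval_scale. Qed.

Lemma feval_bind_linear (L : V -> V) g v : linear L ->
  (forall w, feval (g w) = L (state w)) -> feval (fbind g v) = L (feval v).
Proof.
move=> Llin gL; rewrite feval_bind; under eq_bigr do rewrite gL.
elim: v => [|t v IH].
  rewrite feval_nil big_nil.
  by have := Llin (-1) 0 0; rewrite scaler0 addr0 scaleN1r addNr => ->.
by rewrite big_cons IH feval_cons Llin.
Qed.

Lemma feval_bind_id g v : (forall w, feval (g w) = state w) ->
  feval (fbind g v) = feval v.
Proof. by move=> gE; apply: (@feval_bind_linear idfun). Qed.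

Lemma feval_annihilate x j w : feval (annihilate x j w) = gen x⟦j%:Z⟧ state w.
Proof.
elim: w x j => [|[y n] w IH] x j; first by rewrite feval_nil nprod_vacr0.
rewrite [state _]/= (gen_commutator aff) !feval_cat -addrA.
congr (_ + (_ + _)).
- rewrite -IH /feval big_map raddf_sum /=; apply: eq_bigr => t _.
  by rewrite linearZ.
- rewrite feval_scale ceval_int; congr (_ *: _).
  case: leqP => jn; first by rewrite feval_word /=; congr (_⟦_⟧ _); rewrite !NegzE; lia.
  by rewrite IH; congr (_⟦_⟧ _); rewrite !NegzE; lia.
- rewrite (_ : (j%:Z + Negz n == 0) = (j == n.+1)); last by rewrite NegzE; lia.
  case: eqP => _; last by rewrite feval_nil scale0r.
  rewrite /feval big_seq1 /= mulr0 addr0 add0r Z_of_intK; congr (_ *: _).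
  by rewrite mulrC.
Qed.

Lemma feval_mode w (n : int) y : feval (fmode w n y) = state w⟦n⟧ state y.
Proof.
elim: w n y => [|[x p] w IH] n y.
  by rewrite [state [::]]/= vac_mode /=; case: ifP => _; rewrite ?feval_word ?feval_nil.
case: w IH => [|q w] IH.
  rewrite [state [:: _]]/= derivative_mode /=; case: n => [m|q].
    case: ifP => _; rewrite ?feval_nil // feval_scale feval_annihilate ceval_int.
    by rewrite rmorphM rmorphXn rmorphN1.
  by rewrite /feval big_seq1; congr (_ *: _); exact: (ceval_int 'C(p + q, q)%:Z).
move: (q :: w) (fmode_cons x p q w n y) IH => {q w} u -> IH.
set B1 := (X in flatten [seq _ | _ <- iota 0 X] ++ _).
have us := words_state e h f (ltnSn (size u)).
have ys := words_state e h f (ltnSn (size y)).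
have uy0 j : (B1 <= j)%N -> state u⟦n + j%:Z⟧ state y = 0.
  move=> Bj; apply: (words_neg (words_nprod aff _ us ys)).
  by move: Bj; rewrite /B1; case uyn: (_ - n) => [b|b]; lia.
have y0 j : ((degree y).+1 <= j)%N -> gen x⟦j%:Z⟧ state y = 0.
  by move=> yj; apply: (words_neg (words_annihilate aff x j ys)); lia.
rewrite feval_cat [state _]/= (iterate_finite p uy0 y0) !feval_flatten /index_iota !subn0.
congr (_ + _); apply: eq_bigr => j _; rewrite feval_scale ceval_int.
  congr (_ *: _).
  rewrite (@feval_bind_linear (nprod (gen x) (Negz (p + j)))) ?IH //.
    exact: nprod_linear_r.
  by move=> z; rewrite feval_word.
rewrite rmorphM rmorphXn rmorphN1; congr (_ *: _).
rewrite (@feval_bind_linear (nprod (state u) (n - (p.+1 + j)%N%:Z))) ?feval_annihilate //.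
exact: nprod_linear_r.
Qed.

Lemma feval_insert fuel l w : feval (insert fuel l w) = state (l :: w).
Proof.
elim: fuel l w => [|fuel IH] l w; first exact: feval_word.
case: w => [|l' w]; first exact: feval_word.
rewrite /=; case: ifP => _; first exact: feval_word.
have ll0 : (Negz l.2 + Negz l'.2 == 0) = false by rewrite !NegzE; lia.
rewrite feval_cat feval_scale ceval_int IH (gen_commutator aff) ll0 scale0r addr0.
congr (_ + _ *: _).
rewrite (@feval_bind_linear (nprod (gen l'.1) (Negz l'.2))) ?IH //.
exact: nprod_linear_r.
Qed.

Lemma feval_order_word fuel w : feval (order_word fuel w) = state w.
Proof.
elim: w => [|l w IH] /=; first exact: feval_word.
rewrite (@feval_bind_linear (nprod (gen l.1) (Negz l.2))) ?IH //.
  exact: nprod_linear_r.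
by move=> z; rewrite feval_insert.
Qed.

Lemma feval_collect v : feval (collect v) = feval v.
Proof.
have -> : feval v = feval (foldr add_term [::] v).
  elim: v => //= t v IH; rewrite feval_cons {}IH.
  elim: (foldr _ _ _) => [|s u IH] /=; first by rewrite feval_cons.
  case: eqP => [st|_]; last by rewrite !feval_cons -IH addrCA.
  by rewrite !feval_cons /= ceval_add scalerDl st addrA [_ *: _ + _ *: _]addrC.
rewrite /collect; elim: (foldr _ _ _) => //= t u IH.
case: ifP => [_|/hasPn t0]; rewrite !feval_cons IH //.
rewrite (_ : ceval t.1 = 0) ?scale0r ?add0r //.
elim: t.1 t0 => //= a p IHp /= t0.
rewrite IHp ?mulr0 ?addr0 => [|b bp]; last by rewrite t0 // inE bp orbT.
by have := t0 a (mem_head _ _); rewrite negbK => /eqP->; rewrite rmorph0.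
Qed.

Lemma feval_normalize v : feval (normalize v) = feval v.
Proof.
by rewrite feval_collect; apply: feval_bind_id => w; exact: feval_order_word.
Qed.

Lemma feval_nprod v n v' : feval (fnprod v n v') = feval v⟦n⟧ feval v'.
Proof.
rewrite feval_normalize.
apply: (@feval_bind_linear (nprod (feval v) n)); first exact: nprod_linear_r.
move=> y; apply: (@feval_bind_linear (fun x => x⟦n⟧ state y)).
  exact: nprod_linear_l.
by move=> w; rewrite feval_mode.
Qed.

Lemma homogeneous_neutral d v : homogeneous d v -> neutral d (feval v).
Proof.
elim: v => [|t v IH] /=.
  by rewrite feval_nil => _; exact: submod0 (neutral_submodule e h f d).
move=> /andP[/andP[/eqP t0 /eqP td] /IH vd]; rewrite feval_cons.
have [_] := neutral_submodule e h f d; apply => //.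
by rewrite -td; exact: neutral_state.
Qed.

Lemma in_parafermion d v : commutes_with_h d v ->
  vsub_set (parafermion h) (feval v).
Proof.
case/andP=> vd /allP h0.
suff: forall n : int, 0 <= n -> h⟦n⟧ feval v = 0 by [].
case=> [n|//] _.
have [nd|nd] := leqP n d.
  have := h0 n; rewrite mem_iota => /(_ nd) /nilP hn.
  have := feval_normalize (fbind (annihilate H n) v); rewrite hn feval_nil.
  rewrite (@feval_bind_linear (nprod h n)) => [->//||w].
    exact: nprod_linear_r.
  exact: feval_annihilate.
have [s vs] := homogeneous_neutral vd.
by apply: (words_neg (words_annihilate aff H n vs)); lia.
Qed.

Lemma split_wordP d w : (1 < d)%N -> wcharge w = 0 -> degree w = d ->
  decomposable d (state w - feval (split_word w)).
Proof.
move=> d1 w0 wd.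
have same u : u = fword w -> decomposable d (state w - feval u).
  move=> ->; rewrite feval_word subrr.
  exact: submod0 (decomposable_submodule e h f d).
case: w w0 wd same => [|[[] a] u] w0 wd same; try exact: same.
  set i := find (fun l => l.1 == F) u; set y := take i u ++ drop i.+1 u.
  have splitP w : decomposable d (state ((E, a) :: u) - feval
      (if (wcharge y == 0) && (0 < degree y)%N &&
          ((a + (nth (F, 0%N) u i).2).+2 + degree y == degree ((E, a) :: u))%N then
        fword ((E, a) :: u) ++ fscale [:: (-1)%R]
          (fmode [:: (E, a); (F, (nth (F, 0%N) u i).2)] (-1) y)
       else fword ((E, a) :: u))).
    case: ifP => [|_]; last exact: same.
    move=> /andP[/andP[/eqP y0 y_gt0] /eqP yd].
    rewrite feval_cat feval_word opprD addrA subrr add0r feval_scale feval_mode.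
    rewrite -scaleNr; apply: submodZ; first exact: decomposable_submodule.
    apply: (decomposable_nprod (p := (a + (nth (F, 0%N) u i).2).+2) (q := degree y)
      (m := 0)); try lia.
      exact: quadratic_neutral.
    exact: neutral_state.
  case: u w0 wd same @i @y splitP => [|[[] b] [|l u]] w0 wd same i y splitP //;
    by [exact: same|exact: splitP].
rewrite feval_nil subr0; apply: decomposable_create_h => //.
by move: w0; rewrite /= add0r.
Qed.

Lemma split_formP d v : (1 < d)%N -> homogeneous d v ->
  decomposable d (feval v - feval (split_form v)).
Proof.
move=> d1; rewrite feval_normalize.
elim: v => [|t v IH] /=.
  by rewrite subrr => _; exact: submod0 (decomposable_submodule e h f d).
move=> /andP[/andP[/eqP t0 /eqP td] /IH vd].
rewrite feval_cons feval_cat feval_scale opprD addrACA -scalerBr.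
have [_] := decomposable_submodule e h f d; apply => //.
exact: split_wordP.
Qed.

Lemma class_ofP d v p : (1 < d)%N -> class_of d v = Some p ->
  has_class d (feval v) (ceval p).
Proof.
move=> d1; rewrite /class_of; case: ifP => // /and4P[v0 v1 v2 vq] [<-].
apply: has_class_sub (split_formP d1 v0) _.
apply: has_class_sub (split_formP d1 v1) _.
elim: (split_form (split_form v)) v2 vq => [|[q w] u IH] /=.
  by move=> _ _; rewrite feval_nil; exact: has_class_zero.
move=> /andP[/andP[w0 /eqP wd] /IH ud] /andP[wq /ud uP].
rewrite feval_cons ceval_add; apply: has_classD => //.
case: w w0 wd wq => [|[[] a] [|[[] b] [|]]] //= _ wd _.
have qE : ceval (quadratic_coef (q, [:: (E, a); (F, b)])) =
    ceval q * ((-1) ^+ b * 'C(d.-2, b)%:R).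
  rewrite /quadratic_coef ceval_mul (ceval_int ((-1) ^+ b * 'C(a + b, b)%:Z)).
  by rewrite (_ : d.-2 = (a + b)%N) ?rmorphM ?rmorphXn ?rmorphN1 //; lia.
by rewrite qE; apply: has_classZ; apply: has_class_quadratic; lia.
Qed.

End Evaluation.

(** * The generators *)

Section Generators.
Local Open Scope Z_scope.

(** [2 k (k + 2)] times the conformal vector. *)
Definition L_form : form :=
  [:: ([:: 0; -1], [:: (H, 1%N)]);
      ([:: -1], [:: (H, 0%N); (H, 0%N)]);
      ([:: 0; 2], [:: (E, 0%N); (F, 0%N)])].

Definition W3_form : form :=
  [:: ([:: 0; 0; 1], [:: (H, 2%N)]);
      ([:: 0; 3], [:: (H, 1%N); (H, 0%N)]);
      ([:: 2], [:: (H, 0%N); (H, 0%N); (H, 0%N)]);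
      ([:: 0; -6], [:: (H, 0%N); (E, 0%N); (F, 0%N)]);
      ([:: 0; 0; 3], [:: (E, 1%N); (F, 0%N)]);
      ([:: 0; 0; -3], [:: (E, 0%N); (F, 1%N)])].

Definition W4_form : form :=
  [:: ([:: 0; 0; -2; -2; -2], [:: (H, 3%N)]);
      ([:: 0; -8; -8; -8], [:: (H, 2%N); (H, 0%N)]);
      ([:: 0; 6; 0; -5], [:: (H, 1%N); (H, 1%N)]);
      ([:: 0; -12; -22], [:: (H, 1%N); (H, 0%N); (H, 0%N)]);
      ([:: -6; -11], [:: (H, 0%N); (H, 0%N); (H, 0%N); (H, 0%N)]);
      ([:: 0; 0; -20; 24], [:: (H, 1%N); (E, 0%N); (F, 0%N)]);
      ([:: 0; 24; 44], [:: (H, 0%N); (H, 0%N); (E, 0%N); (F, 0%N)]);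
      ([:: 0; 0; -44; -20], [:: (H, 0%N); (E, 1%N); (F, 0%N)]);
      ([:: 0; 0; 44; 20], [:: (H, 0%N); (E, 0%N); (F, 1%N)]);
      ([:: 0; 0; 48; -40; 8], [:: (E, 2%N); (F, 0%N)]);
      ([:: 0; 0; -32; 12; -12], [:: (E, 1%N); (F, 1%N)]);
      ([:: 0; 0; 10; -12], [:: (E, 0%N); (E, 0%N); (F, 0%N); (F, 0%N)]);
      ([:: 0; 0; 8; 8; 8], [:: (E, 0%N); (F, 2%N)])].

Definition W5_form : form :=
  [:: ([:: 0; 0; 0; -10; -6; -2], [:: (H, 4%N)]);
      ([:: 0; 0; -50; -30; -10], [:: (H, 3%N); (H, 0%N)]);
      ([:: 0; 0; 20; 0; -15], [:: (H, 2%N); (H, 1%N)]);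
      ([:: 0; -80; -60; -35], [:: (H, 2%N); (H, 0%N); (H, 0%N)]);
      ([:: 0; 60; 0; -45], [:: (H, 1%N); (H, 1%N); (H, 0%N)]);
      ([:: 0; -60; -95], [:: (H, 1%N); (H, 0%N); (H, 0%N); (H, 0%N)]);
      ([:: -24; -38], [:: (H, 0%N); (H, 0%N); (H, 0%N); (H, 0%N); (H, 0%N)]);
      ([:: 0; 0; 80; -70; 40], [:: (H, 2%N); (E, 0%N); (F, 0%N)]);
      ([:: 0; 0; -140; 200], [:: (H, 1%N); (H, 0%N); (E, 0%N); (F, 0%N)]);
      ([:: 0; 120; 190], [:: (H, 0%N); (H, 0%N); (H, 0%N); (E, 0%N); (F, 0%N)]);
      ([:: 0; 0; -60; 70; -55], [:: (H, 1%N); (E, 1%N); (F, 0%N)]);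
      ([:: 0; 0; -320; -85], [:: (H, 0%N); (H, 0%N); (E, 1%N); (F, 0%N)]);
      ([:: 0; 0; -60; 0; 45], [:: (H, 1%N); (E, 0%N); (F, 1%N)]);
      ([:: 0; 0; 320; 85], [:: (H, 0%N); (H, 0%N); (E, 0%N); (F, 1%N)]);
      ([:: 0; 0; 360; -210; 30], [:: (H, 0%N); (E, 2%N); (F, 0%N)]);
      ([:: 0; 0; -200; -120; -40], [:: (H, 0%N); (E, 1%N); (F, 1%N)]);
      ([:: 0; 0; 70; -100], [:: (H, 0%N); (E, 0%N); (E, 0%N); (F, 0%N); (F, 0%N)]);
      ([:: 0; 0; 80; 190; 30], [:: (H, 0%N); (E, 0%N); (F, 2%N)]);
      ([:: 0; 0; 0; -120; 70; -10], [:: (E, 3%N); (F, 0%N)]);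
      ([:: 0; 0; 0; 240; -140; 20], [:: (E, 2%N); (F, 1%N)]);
      ([:: 0; 0; 0; -35; 50], [:: (E, 1%N); (E, 0%N); (F, 0%N); (F, 0%N)]);
      ([:: 0; 0; 0; -170; 40; -20], [:: (E, 1%N); (F, 2%N)]);
      ([:: 0; 0; 0; 35; -50], [:: (E, 0%N); (E, 0%N); (F, 1%N); (F, 0%N)]);
      ([:: 0; 0; 0; 50; 30; 10], [:: (E, 0%N); (F, 3%N)])].

Definition Z4_form : form := Eval vm_compute in fnprod W3_form 1 W3_form.
Definition Z5_form : form := Eval vm_compute in fnprod W3_form 1 Z4_form.

Lemma W3_W3 : fnprod W3_form 1 W3_form = Z4_form.
Proof. by vm_compute. Qed.

Lemma W3_Z4 : fnprod W3_form 1 Z4_form = Z5_form.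
Proof. by vm_compute. Qed.

Lemma L_commutes : commutes_with_h 2 L_form.
Proof. by vm_compute. Qed.

Lemma W3_commutes : commutes_with_h 3 W3_form.
Proof. by vm_compute. Qed.

Lemma W4_commutes : commutes_with_h 4 W4_form.
Proof. by vm_compute. Qed.

Lemma W5_commutes : commutes_with_h 5 W5_form.
Proof. by vm_compute. Qed.

Lemma Z4_commutes : commutes_with_h 4 Z4_form.
Proof. by vm_compute. Qed.

Lemma Z5_commutes : commutes_with_h 5 Z5_form.
Proof. by vm_compute. Qed.

Lemma L_class : class_of 2 L_form = Some [:: 0; 2].
Proof. by vm_compute. Qed.

Lemma W3_class : class_of 3 W3_form = Some [:: 0; 0; 6].
Proof. by vm_compute. Qed.

Lemma W4_class : class_of 4 W4_form = Some [:: 0; 0; 0; 68; 64].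
Proof. by vm_compute. Qed.

Lemma W5_class : class_of 5 W5_form = Some [:: 0; 0; 0; 0; -1070; -640].
Proof. by vm_compute. Qed.

Lemma Z4_class : class_of 4 Z4_form = Some [:: 0; 0; 0; 0; 432; 288].
Proof. by vm_compute. Qed.

Lemma Z5_class : class_of 5 Z5_form =
  Some [:: 0; 0; 0; 0; 0; 0; 51840; 73440; 25920].
Proof. by vm_compute. Qed.

End Generators.

(** * From charge zero vectors to the commutant of [h] *)

Section ParafermionGeneration.
Context (K : numFieldType) (k : K) (V : vertexAlgebra K) (e h f : V).
Context (aff : affine_sl2 k e h f) (k_neq0 : k != 0).
Context (gen_V : generates [set x | x \in [:: e; h; f]]%classic).
Implicit Types (w : word) (u v x y : V) (d j m n : nat).

Local Notation state := (state e h f).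
Local Notation neutral := (neutral e h f).
Local Notation has_class := (has_class e h f).

Definition word_span : set V := spanned (fun v => exists w, v = state w).

Lemma word_span_submodule : is_submodule word_span.
Proof. exact: spanned_submodule. Qed.

Lemma word_span_nprod x (n : int) y :
  word_span x -> word_span y -> word_span (x⟦n⟧ y).
Proof.
move=> xs ys; move: x xs.
apply: (spanned_linear (nprod_linear_l _ _) word_span_submodule) => _ [w ->].
move: y ys.
apply: (spanned_linear (nprod_linear_r _ _) word_span_submodule) => _ [w' ->].
have := words_nprod_state aff w n (words_state e h f (ltnSn (size w'))).
by apply: spannedS => _ [u [_ _ _ ->]]; exists u.
Qed.

Lemma word_span_vac : word_span vac.
Proof. by apply: subset_spanned; exists [::]. Qed.

Lemma word_span_full v : word_span v.
Proof.
pose A := VertexSubalgebra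
  ((is_submoduleP word_span).1 word_span_submodule) word_span_vac word_span_nprod.
suff A_full : A = setT :> set V.
  by have : (setT : set V) v by []; rewrite -A_full.
apply: gen_V => x /=; rewrite !inE => /or3P[] /eqP->; apply: subset_spanned.
- by exists [:: (E, 0%N)]; rewrite /= nprod_vacr.
- by exists [:: (H, 0%N)]; rewrite /= nprod_vacr.
- by exists [:: (F, 0%N)]; rewrite /= nprod_vacr.
Qed.

Lemma h0_state w : h⟦0⟧ state w = (2 * wcharge w)%:~R *: state w.
Proof.
elim: w => [|[y n] w IH]; first by rewrite nprod_vacr0 // mulr0 scale0r.
have n0 : (0 + Negz n == 0) = false by [].
rewrite /= (gen_commutator aff H y) n0 scale0r addr0 add0r [h⟦0⟧ state w]IH.
rewrite nprodZr mulrDr intrD scalerDl addrC.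
by case: y => /=; rewrite ?mulr0 ?scale0r.
Qed.

(** The words span [V] and are eigenvectors of [h(0)], with eigenvalue twice
    their charge. *)
Lemma charge_zero_neutral (A : set V) v : is_submodule A ->
  (forall d u, neutral d u -> A u) -> h⟦0⟧ v = 0 -> A v.
Proof.
move=> AS nA v0.
have eigen x : (exists w, x = state w) -> exists a, h⟦0⟧ x = a *: x.
  by case=> w ->; eexists; exact: h0_state.
have := kernel_of_diagonal (nprod_linear_r h 0) eigen (word_span_full v) v0.
move: v {v0}; apply: (spanned_min AS) => _ [[w ->]].
rewrite h0_state => /eqP; rewrite scaler_eq0 intr_eq0 mulf_eq0 /=.
case/orP => [/eqP w0|/eqP->]; last by case: AS.
exact: nA (@neutral_state _ _ e h f w w0).
Qed.

Section NeutralGenerators.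
Context (gs : seq V) (gs_parafermion : forall g, g \in gs -> vsub_set (parafermion h) g).
Implicit Types (l : seq nat) (s : seq (V * nat)).

Definition product s : V := foldr (fun p v => p.1⟦Negz p.2⟧ v) vac s.
Definition h_product l v : V := foldr (fun n v => h⟦Negz n⟧ v) v l.
Definition over s := all (fun p => p.1 \in gs) s.

Lemma h_commute g (m n : int) v : g \in gs -> h⟦m⟧ g⟦n⟧ v = g⟦n⟧ h⟦m⟧ v.
Proof. by move=> /gs_parafermion hg; apply: commute_modes. Qed.

Lemma product_parafermion s (n : int) : over s -> 0 <= n -> h⟦n⟧ product s = 0.
Proof.
elim: s => [|p s IH] /=; first by move=> _; apply: nprod_vacr0.
by move=> /andP[ps ss] n0; rewrite h_commute // IH ?nprod0.
Qed.

Lemma create_h_product g n l s : g \in gs ->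
  g⟦Negz n⟧ h_product l (product s) = h_product l (product ((g, n) :: s)).
Proof. by move=> gg; elim: l => //= m l <-; rewrite h_commute. Qed.

Lemma monomial_factorization (s : seq (V * nat)) :
  all (fun p => p.1 \in h :: gs) s ->
  exists l s', over s' /\ product s = h_product l (product s').
Proof.
elim: s => [|[g n] s IH] /=; first by exists [::], [::].
move=> /andP[+ /IH[l [s' [os' ->]]]]; rewrite inE => /predU1P[->|gg].
  by exists (n :: l), s'.
by exists l, ((g, n) :: s'); rewrite create_h_product //= gg.
Qed.

Lemma h_mode_commutator m n v : h⟦m.+1%:Z⟧ h⟦Negz n⟧ v =
  h⟦Negz n⟧ h⟦m.+1%:Z⟧ v + (if m == n then 2 * k * m.+1%:R else 0) *: v.
Proof.
rewrite (gen_commutator aff H H) /= mulr0z scale0r addr0.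
rewrite (_ : (m.+1%:Z + Negz n == 0) = (m == n)); last by rewrite NegzE; lia.
case: eqP => // _; congr (_ + _ *: _).
by rewrite intrM /=; ring.
Qed.

(** The number operator of the first [B] oscillators of the Heisenberg field. *)
Definition number (B : nat) v : V :=
  \sum_(0 <= n < B) (2 * k * n.+1%:R)^-1 *: h⟦Negz n⟧ h⟦n.+1%:Z⟧ v.

Lemma number_linear B : linear (number B).
Proof.
move=> a u v; rewrite /number scaler_sumr -big_split /=.
apply: eq_bigr => n _; rewrite !nprodDr !nprodZr scalerDr !scalerA.
by rewrite [_ * a]mulrC.
Qed.

Lemma number_product B l s : over s -> all (fun n => (n < B)%N) l ->
  number B (h_product l (product s)) = (size l)%:R *: h_product l (product s).
Proof.
move=> os; elim: l => [_|m l IH /andP[mB /IH lB]] /=.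
  rewrite scale0r /number big1 // => n _.
  by rewrite product_parafermion // nprod0 scaler0.
rewrite -natr1 scalerDl scale1r -nprodZr -lB /number.
have hh n u : h⟦Negz n⟧ h⟦Negz m⟧ u = h⟦Negz m⟧ h⟦Negz n⟧ u.
  by rewrite (gen_commutator aff H H) /= mulr0z !scale0r !addr0.
have nprod_sum r (G : nat -> V) :
    h⟦Negz m⟧ (\sum_(n <- r) G n) = \sum_(n <- r) h⟦Negz m⟧ (G n).
  by elim: r => [|n r IHr]; rewrite ?big_nil ?nprod0 // !big_cons nprodDr IHr.
rewrite nprod_sum; set v := h_product l _.
have delta : h⟦Negz m⟧ v = \sum_(0 <= n < B) (if n == m then h⟦Negz m⟧ v else 0).
  rewrite (bigD1_seq m) ?iota_uniq ?mem_index_iota //= eqxx big1 ?addr0 //.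
  by move=> n /negbTE->.
rewrite [X in _ = _ + X]delta -big_split /=; apply: eq_bigr => n _.
rewrite h_mode_commutator nprodDr nprodZr hh nprodZr scalerDr; congr (_ + _).
case: eqP => [->|_]; last by rewrite scale0r scaler0.
by rewrite scalerA mulVf ?scale1r // !mulf_neq0 ?pnatr_eq0.
Qed.

(** The number operator has eigenvalue [size l] on [h_product l (product s)] and
    annihilates the commutant of [h]. *)
Lemma parafermion_projection v :
  spanned (fun v => exists l s, over s /\ v = h_product l (product s)) v ->
  vsub_set (parafermion h) v -> spanned (fun v => exists s, over s /\ v = product s) v.
Proof.
move=> vs hv.
have [B vB] : exists B, spanned (fun v => exists l s,
    [/\ over s, all (fun n => (n < B)%N) l & v = h_product l (product s)]) v.
  elim: {hv} vs => [|c _ x [l [s [os ->]]] _ [B xB]].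
    by exists 0%N; exact: spanned0.
  exists (maxn B (\max_(n <- l) n.+1)).
  apply: spanned_cons; last first.
    apply: spannedS xB => _ [l' [s' [os' lB ->]]]; exists l', s'; split=> //.
    by apply: sub_all lB => n nB; rewrite leq_max nB.
  exists l, s; split=> //; apply/allP => n nl; rewrite leq_max; apply/orP; right.
  exact: (leq_bigmax_seq (F := fun i => i.+1)).
have eigen x : (exists l s, [/\ over s, all (fun n => (n < B)%N) l &
    x = h_product l (product s)]) -> exists a, number B x = a *: x.
  by case=> l [s [os lB ->]]; eexists; exact: number_product.
have number0 : number B v = 0.
  by rewrite /number big1 // => n _; rewrite hv // nprod0 scaler0.
have := kernel_of_diagonal (number_linear B) eigen vB number0.
apply: (spanned_min (spanned_submodule _)) => _ [[l [s [os lB ->]]]].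
rewrite number_product // => /eqP; rewrite scaler_eq0 pnatr_eq0 size_eq0.
case/orP => [/eqP->|/eqP->]; last exact: spanned0.
by apply: subset_spanned; exists s.
Qed.

End NeutralGenerators.

Definition parafermion_generator d (g : V) :=
  [/\ vsub_set (parafermion h) g, neutral d g
    & exists2 c, c != 0 & has_class d g c].

Lemma parafermion_generatorZ d (a : K) g : a != 0 ->
  parafermion_generator d g -> parafermion_generator d (a *: g).
Proof.
move=> a0 [hg ng [c c0 gc]]; split.
- by apply: (submodZ ((is_submoduleP _).2 (vsub_submod _))).
- by apply: (submodZ (neutral_submodule e h f d)).
- by exists (a * c); rewrite ?mulf_neq0 //; apply: has_classZ.
Qed.

(** Transport of strong generation from the charge zero subspace, generated by
    [h] and four vectors with nonzero class, to the commutant of [h]. *)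
Lemma parafermion_strongly_generated (g2 g3 g4 g5 : V) :
  parafermion_generator 2 g2 -> parafermion_generator 3 g3 ->
  parafermion_generator 4 g4 -> parafermion_generator 5 g5 ->
  strongly_generated (parafermion h) [:: g2; g3; g4; g5].
Proof.
move=> [hg2 n2 [c2 c2_0 h2]] [hg3 n3 [c3 c3_0 h3]] [hg4 n4 [c4 c4_0 h4]].
move=> [hg5 n5 [c5 c5_0 h5]].
have hg g : g \in [:: g2; g3; g4; g5] -> vsub_set (parafermion h) g.
  by rewrite !inE => /or4P[] /eqP->.
split=> // v hv.
set gs := [:: g2; g3; g4; g5].
pose gens : seq (V * nat) :=
  [:: (h, 1%N); (g2, 2%N); (g3, 3%N); (g4, 4%N); (g5, 5%N)].
have gens_neutral g : g \in gens -> (0 < g.2)%N /\ neutral g.2 g.1.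
  rewrite !inE => /or4P[|||/orP[]] /eqP-> //=; split=> //.
  have := @neutral_state _ _ e h f [:: (H, 0%N)] erefl.
  by rewrite /= nprod_vacr.
have sub_class d u g (a b : K) : has_class d u a -> has_class d g b -> b != 0 ->
    decomposable e h f d (u - (a / b) *: g).
  move=> ua gb b0; apply/has_class0; have -> : 0 = a - a / b * b by rewrite mulfVK // subrr.
  by apply: has_classB => //; apply: has_classZ.
have gens_indec d u : (0 < d)%N -> neutral d u -> decomposable e h f d u \/
    exists g c, (g, d) \in gens /\ decomposable e h f d (u - c *: g).
  case: d => [//|[|d]] _ nu.
    have [c ->] := neutral_degree1 nu; right; exists h, c; split.
      by rewrite mem_head.
    by rewrite subrr; exact: submod0 (decomposable_submodule e h f 1).
  have [|a ua] := neutral_class aff _ nu; first by [].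
  case: d {nu} ua => [|[|[|[|d]]]] ua; last first.
    left; move: ua; rewrite /has_class.
    have /(submodZ (decomposable_submodule e h f _) a) := decoupling aff k_neq0
      (isT : (5 < d.+2.+4)%N).
    move=> dec ua; have := submodD (decomposable_submodule e h f _) ua dec.
    by rewrite subrK.
  - by right; exists g5, (a / c5); rewrite !inE eqxx !orbT; split=> //; apply: sub_class ua h5 _.
  - by right; exists g4, (a / c4); rewrite !inE eqxx !orbT; split=> //; apply: sub_class ua h4 _.
  - by right; exists g3, (a / c3); rewrite !inE eqxx !orbT; split=> //; apply: sub_class ua h3 _.
  - by right; exists g2, (a / c2); rewrite !inE eqxx !orbT; split=> //; apply: sub_class ua h2 _.
have {gens_indec gens_neutral} gen_neutral d u :=
  strong_generation aff gens_neutral gens_indec (d := d) (v := u).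
have : spanned (fun u => exists l s, over gs s /\ u = h_product l (product s)) v.
  have h0v : h⟦0⟧ v = 0 by apply: hv.
  move: h0v; apply: (charge_zero_neutral (spanned_submodule _)) => d u nu.
  move: (gen_neutral d u nu); apply: spannedS => _ [s [os ->]].
  exact: (monomial_factorization hg os).
move=> /(parafermion_projection hg)/(_ hv) vs.
apply: spanned_lspan; apply: spannedS vs => _ [s [os ->]].
exists [seq (p.1, p.2.+1) | p <- s]; last by elim: s {os} => //= p s ->.
by rewrite /= all_map; apply: sub_all os => p /= ->.
Qed.

End ParafermionGeneration.

(** * The generators as vectors *)

Section GeneratorForms.
Context (K : numFieldType) (k : K) (V : vertexAlgebra K) (e h f : V).
Context (aff : affine_sl2 k e h f).

Local Notation feval := (feval k e h f).
Local Notation ceval := (ceval k).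

(* [ring] does not see through the binary integers of a coefficient, hence the
   rewriting rules [zvalE]. *)
Let zval (z : Z) : K := (int_of_Z z)%:~R.

Let zvalE : (zval Z0 = 0) * (zval (Zpos xH) = 1) *
  (forall p, zval (Zpos (xO p)) = 2 * zval (Zpos p)) *
  (forall p, zval (Zpos (xI p)) = 1 + 2 * zval (Zpos p)) *
  (forall p, zval (Zneg p) = - zval (Zpos p)).
Proof.
split; last first.
  by move=> p; rewrite /zval -mulrNz; congr (_%:~R); rewrite -rmorphN.
split; last first.
  move=> p; rewrite /zval (_ : Zpos (xI p) = 1 + (Zpos (xO xH)) * Zpos p) //.
  by rewrite rmorphD rmorphM intrD intrM.
split; last first.
  move=> p; rewrite /zval (_ : Zpos (xO p) = (Zpos (xO xH)) * Zpos p) //.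
  by rewrite rmorphM intrM.
by [].
Qed.

Let cevalE (a : Z) (p : coef) : ceval (a :: p) = zval a + k * ceval p.
Proof. by []. Qed.

Lemma W3_formE : parafermion_W3 k e h f = feval W3_form.
Proof.
rewrite /parafermion_W3 -!scaleNr fevalE !big_cons big_nil addr0 !addrA.
do 5?[congr (_ + _)]; congr (_ *: _); rewrite !cevalE !zvalE /=; ring.
Qed.

Lemma W4_formE : parafermion_W4 k e h f = feval W4_form.
Proof.
rewrite /parafermion_W4 -!scaleNr fevalE !big_cons big_nil addr0 !addrA.
do 12?[congr (_ + _)]; congr (_ *: _); rewrite !cevalE !zvalE /=; ring.
Qed.

Lemma W5_formE : parafermion_W5 k e h f = feval W5_form.
Proof.
rewrite /parafermion_W5 -!scaleNr fevalE !big_cons big_nil addr0 !addrA.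
do 23?[congr (_ + _)]; congr (_ *: _); rewrite !cevalE !zvalE /=; ring.
Qed.

Lemma L_formE : parafermion_L k e h f = (2 * k * (k + 2))^-1 *: feval L_form.
Proof.
rewrite /parafermion_L -[h⟦-1⟧ h⟦-1⟧ vac]scale1r -!scaleNr.
rewrite fevalE !big_cons big_nil addr0 !addrA.
congr (_ *: (_ + _ + _)); congr (_ *: _); rewrite !cevalE !zvalE /=; ring.
Qed.

Lemma segal_sugawara_formE : k = -2 ->
  segal_sugawara e h f = (- 2^-1) *: feval L_form.
Proof.
move=> k2; rewrite /segal_sugawara.
have -> : e⟦-1⟧ f = e⟦-1⟧ f⟦-1⟧ vac by rewrite nprod_vacr.
have -> : h⟦-1⟧ h = h⟦-1⟧ h⟦-1⟧ vac by rewrite nprod_vacr.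
have -> : f⟦-1⟧ e = e⟦-1⟧ f⟦-1⟧ vac - h⟦-2⟧ vac.
  have := gen_commutator aff F E (-1) (-1) vac.
  by rewrite /= scale0r addr0 scaleN1r nprod_vacr.
rewrite fevalE !big_cons big_nil addr0 !scalerDr !scalerA.
rewrite addrA -[e⟦-1⟧ _ + e⟦-1⟧ _]mulr2n -scaler_nat.
rewrite -addrA addrC -addrA -scaleN1r.
by congr (_ *: _ + (_ *: _ + _ *: _)); rewrite !cevalE !zvalE /= k2; field.
Qed.

Lemma form_standard_degree d (v : form) c : homogeneous d v ->
  standard_degree e h f d (c *: feval v).
Proof.
move=> vd; apply: spanned_lspan; apply: submodZ; first exact: spanned_submodule.
elim: v vd => [|t v IH] /=; first by rewrite fevalE big_nil => _; exact: spanned0.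
move=> /andP[/andP[_ /eqP td] /IH vd]; rewrite fevalE big_cons.
apply: spanned_cons => //; exists [seq (gen e h f l.1, l.2.+1) | l <- t.2].
  split; last first.
    rewrite big_map -td; elim: (t.2) => [|l w IHw]; first by rewrite big_nil.
    by rewrite big_cons /= IHw.
  by rewrite all_map; apply/allP => -[[] n] _ /=; rewrite !inE eqxx ?orbT.
by elim: (t.2) => //= l w ->.
Qed.

Local Notation generator := (parafermion_generator e h f).

Let form_generator d v p c : (1 < d)%N -> commutes_with_h d v ->
  class_of d v = Some p -> ceval p = c -> c != 0 -> generator d (feval v).
Proof.
move=> d1 vh vp <- p0; split; first exact: (in_parafermion aff vh).
  by have [/homogeneous_neutral + _] := andP vh; apply.
by exists (ceval p) => //; exact: (class_ofP aff d1 vp).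
Qed.

Lemma L_generator : 2 * k != 0 -> generator 2 (feval L_form).
Proof.
by apply: (form_generator _ L_commutes L_class) => //; rewrite !cevalE !zvalE /=; ring.
Qed.

Lemma W3_generator : 6 * k ^+ 2 != 0 -> generator 3 (feval W3_form).
Proof.
by apply: (form_generator _ W3_commutes W3_class) => //; rewrite !cevalE !zvalE /=; ring.
Qed.

Lemma W4_generator : 4 * k ^+ 3 * (16 * k + 17) != 0 ->
  generator 4 (feval W4_form).
Proof.
by apply: (form_generator _ W4_commutes W4_class) => //; rewrite !cevalE !zvalE /=; ring.
Qed.

Lemma W5_generator : - (10 * k ^+ 4 * (64 * k + 107)) != 0 ->
  generator 5 (feval W5_form).
Proof.
by apply: (form_generator _ W5_commutes W5_class) => //; rewrite !cevalE !zvalE /=; ring.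
Qed.

Lemma Z4_generator : 144 * k ^+ 4 * (2 * k + 3) != 0 ->
  generator 4 (feval Z4_form).
Proof.
by apply: (form_generator _ Z4_commutes Z4_class) => //; rewrite !cevalE !zvalE /=; ring.
Qed.

Lemma Z5_generator : 4320 * k ^+ 6 * (2 * k + 3) * (3 * k + 4) != 0 ->
  generator 5 (feval Z5_form).
Proof.
by apply: (form_generator _ Z5_commutes Z5_class) => //; rewrite !cevalE !zvalE /=; ring.
Qed.

Lemma Z4_formE : parafermion_Z4 k e h f = feval Z4_form.
Proof. by rewrite /parafermion_Z4 W3_formE -(feval_nprod aff) W3_W3. Qed.

Lemma Z5_formE : parafermion_Z5 k e h f = feval Z5_form.
Proof. by rewrite /parafermion_Z5 Z4_formE W3_formE -(feval_nprod aff) W3_Z4. Qed.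

End GeneratorForms.

Theorem theorem4 (R : realType) (k : R[i]) (k_neq0 : k != 0)
    (V : vertexAlgebra R[i]) (e h f : V)
    (V_univ : universal_affine_sl2 k e h f) :
  [/\ k != -2 -> k != - 17 / 16 -> k != - 107 / 64 ->
        strongly_generated (parafermion h)
          [:: parafermion_L k e h f; parafermion_W3 k e h f;
              parafermion_W4 k e h f; parafermion_W5 k e h f],
      k = - 17 / 16 \/ k = - 107 / 64 ->
        strongly_generated (parafermion h)
          [:: parafermion_L k e h f; parafermion_W3 k e h f;
              parafermion_Z4 k e h f; parafermion_Z5 k e h f]
    & k = -2 ->
        strongly_generated (parafermion h)
          [:: segal_sugawara e h f; parafermion_W3 k e h f;
              parafermion_W4 k e h f; parafermion_W5 k e h f] /\
        [/\ standard_degree e h f 2 (segal_sugawara e h f),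
            standard_degree e h f 3 (parafermion_W3 k e h f),
            standard_degree e h f 4 (parafermion_W4 k e h f)
          & standard_degree e h f 5 (parafermion_W5 k e h f)]].
Proof.
have [aff gen_V _] := V_univ.
have criterion := parafermion_strongly_generated aff k_neq0 gen_V.
have n_neq0 n : n.+1%:R != 0 :> R[i] by rewrite pnatr_eq0.
have linear_neq0 (a b : R[i]) : a != 0 -> k != - b / a -> a * k + b != 0.
  move=> a0; apply: contraNneq => /eqP; rewrite addr_eq0 => /eqP <-.
  by rewrite mulrAC mulfV // mul1r.
have gL : parafermion_generator e h f 2 (feval k e h f L_form).
  by apply: L_generator; rewrite // mulf_neq0.
have gW3 : parafermion_generator e h f 3 (feval k e h f W3_form).
  by apply: W3_generator; rewrite // mulf_neq0 ?expf_neq0.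
have gW4 : k != - 17 / 16 -> parafermion_generator e h f 4 (feval k e h f W4_form).
  by move=> k17; apply: W4_generator; rewrite // !mulf_neq0 ?expf_neq0 ?linear_neq0.
have gW5 : k != - 107 / 64 -> parafermion_generator e h f 5 (feval k e h f W5_form).
  move=> k107; apply: W5_generator; rewrite // oppr_eq0.
  by rewrite !mulf_neq0 ?expf_neq0 ?linear_neq0.
rewrite L_formE W3_formE W4_formE W5_formE (Z4_formE aff) (Z5_formE aff).
split=> [k2 k17 k107|k_special|k2].
- apply: criterion => //; [|exact: gW4|exact: gW5].
  apply: parafermion_generatorZ => //.
  rewrite invr_eq0 !mulf_neq0 // -[k]mul1r linear_neq0 ?oner_eq0 //.
  by rewrite divr1.
- have [k2 k3 k4] : [/\ k + 2 != 0, 2 * k + 3 != 0 & 3 * k + 4 != 0].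
    case: k_special => ->; split.
    + by rewrite (_ : _ + _ = 15 / 16) ?mulf_neq0 ?invr_eq0 //; field.
    + by rewrite (_ : _ + _ = 7 / 8) ?mulf_neq0 ?invr_eq0 //; field.
    + by rewrite (_ : _ + _ = 13 / 16) ?mulf_neq0 ?invr_eq0 //; field.
    + by rewrite (_ : _ + _ = 21 / 64) ?mulf_neq0 ?invr_eq0 //; field.
    + by rewrite (_ : _ + _ = - (11 / 32)) ?oppr_eq0 ?mulf_neq0 ?invr_eq0 //; field.
    + by rewrite (_ : _ + _ = - (65 / 64)) ?oppr_eq0 ?mulf_neq0 ?invr_eq0 //; field.
  apply: criterion => //.
  + by apply: parafermion_generatorZ => //; rewrite invr_eq0 !mulf_neq0.
  + by apply: Z4_generator; rewrite // !mulf_neq0 ?expf_neq0.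
  + by apply: Z5_generator; rewrite // !mulf_neq0 ?expf_neq0.
- rewrite (segal_sugawara_formE aff k2); split.
    apply: criterion => //.
    + by apply: parafermion_generatorZ => //; rewrite oppr_eq0 invr_eq0.
    + apply: gW4; rewrite k2 -subr_eq0 (_ : _ - _ = - (15 / 16)); last by field.
      by rewrite oppr_eq0 mulf_neq0 ?invr_eq0.
    + apply: gW5; rewrite k2 -subr_eq0 (_ : _ - _ = - (21 / 64)); last by field.
      by rewrite oppr_eq0 mulf_neq0 ?invr_eq0.
  have degree_form d v : homogeneous d v ->
      standard_degree e h f d (feval k e h f v).
    by move=> vd; rewrite -[feval _ _ _ _ _]scale1r; apply: form_standard_degree.
  by split; [apply: form_standard_degree | apply: degree_form..].
Qed.
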